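(* Let $\lambda=\Phi(\mu,\nu,k)$ with $k\ge0$ be a partition with 2-quotient $(\mu,\nu)$ and 2-core $\bar\lambda=(k,\dots,1)$, and write $R_\lambda(x)=\sum_{j=0}^{|\mu|+|\nu|}r_{\lambda,j}x^{|\mu|+|\nu|-j}$. Then for $j=0,1,\dots,|\mu|+|\nu|$, $$r_{\lambda,j}=(-1)^j\binom{|\mu|+|\nu|}{j}\sum_{(\tilde\mu,\tilde\nu)<_j(\mu,\nu)}(-1)^{\mathrm{ht}_2(\lambda/\tilde\lambda)}\frac{F^{(2)}_{(\tilde\mu,\tilde\nu)}\,F^{(2)}_{(\mu,\nu)/(\tilde\mu,\tilde\nu)}}{F^{(2)}_{(\mu,\nu)}}\,\frac{H_{\mathrm{odd}}(\lambda)}{H_{\mathrm{odd}}(\tilde\lambda)},$$ where $\tilde\lambda=\Phi(\tilde\mu,\tilde\nu,k)$ is the partition with quotient $(\tilde\mu,\tilde\nu)$ and the same core as $\lambda$.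
   Context: Partitions $\lambda=(\lambda_1\ge\dots\ge\lambda_{\ell(\lambda)}>0)$, $|\lambda|=\sum\lambda_i$, degree vector $n_i=\lambda_i+\ell(\lambda)-i$, $\Delta(n_\lambda)=\prod_{i<j}(n_j-n_i)$. Hermite: $\mathrm{He}_0=1,\mathrm{He}_1=x,\mathrm{He}_n=x\mathrm{He}_{n-1}-(n-1)\mathrm{He}_{n-2}$; $\mathrm{He}_\lambda=\mathrm{Wr}[\mathrm{He}_{n_1},\dots,\mathrm{He}_{n_{\ell(\lambda)}}]/\Delta(n_\lambda)$. Maya diagram: a set $M\subset\mathbb{Z}$ containing all sufficiently negative integers and finitely many non-negative ones; $\lambda(M)$ has parts the positive values of $\#\{n\notin M:n<m\}$, $m\in M$. $M_\lambda=\{n<0\}\cup\{n_i\}$, $M_\lambda+t=\{m+t:m\in M_\lambda\}$. For partitions $\mu,\nu$ and $k\in\mathbb{Z}$, choose $s,s'\ge0$ with $\ell(\nu)+s'-\ell(\mu)-s=k$ and set $\Phi(\mu,\nu,k)=\lambda(\{2m:m\in M_\mu+s\}\cup\{2m+1:m\in M_\nu+s'\})$ (independent of $s,s'$). Each partition is uniquely $\Phi(\mu,\nu,k)$ with $k\ge0$; $(\mu,\nu)$ is its 2-quotient and $(k,k-1,\dots,1)$ its 2-core $\bar\lambda$. There is a polynomial $R_\lambda$, monic of degree $|\mu|+|\nu|$, with $\mathrm{He}_\lambda(x)=x^{|\bar\lambda|}R_\lambda(x^2)$. Write $(\tilde\mu,\tilde\nu)<_j(\mu,\nu)$ if $\tilde\mu\subseteq\mu$,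 $\tilde\nu\subseteq\nu$ (inclusion of Young diagrams) and $|\tilde\mu|+|\tilde\nu|+j=|\mu|+|\nu|$. For such a pair, $\tilde\lambda=\Phi(\tilde\mu,\tilde\nu,k)$ is obtained from $\lambda$ by successively removing $j$ dominoes ($1\times2$ or $2\times1$ rectangles), each intermediate shape a Young diagram; $\mathrm{ht}_2(\lambda/\tilde\lambda)$ is the number of vertical dominoes removed (its parity is independent of the sequence). $H_{\mathrm{odd}}(\lambda)$ is the product of the odd hook lengths of $\lambda$. $F_{\alpha/\beta}$ is the number of saturated chains from $\beta$ to $\alpha$ in the Young lattice (partitions ordered by inclusion), $F_\alpha=F_{\alpha/\emptyset}$; $F^{(2)}_{(\mu,\nu)/(\tilde\mu,\tilde\nu)}=\binom{|\mu|-|\tilde\mu|+|\nu|-|\tilde\nu|}{|\mu|-|\tilde\mu|}F_{\mu/\tilde\mu}F_{\nu/\tilde\nu}$ (the number of saturated chains in $\mathbb{Y}\times\mathbb{Y}$) and $F^{(2)}_{(\mu,\nu)}=F^{(2)}_{(\mu,\nu)/(\emptyset,\emptyset)}$. *)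

(* Defs.v *)
From HB Require Import structures.
From mathcomp Require Import all_boot all_order all_algebra.
Set Implicit Arguments. Unset Strict Implicit. Unset Printing Implicit Defensive.
Import Order.TTheory GRing.Theory Num.Theory.

Definition is_part (l : seq nat) : bool :=
  sorted geq l && all (fun x => 0 < x) l.

Definition subpart (a b : seq nat) : bool :=
  (size a <= size b) && all (fun i => nth 0 a i <= nth 0 b i) (iota 0 (size a)).

Fixpoint allseqs (n m : nat) : seq (seq nat) :=
  match n with
  | 0 => [:: [::]]
  | n'.+1 => flatten [seq [seq x :: t | t <- allseqs n' m] | x <- iota 0 m.+1]
  end.

Definition subparts (l : seq nat) : seq (seq nat) :=
  [seq t <- undup [seq filter (fun x => 0 < x) t | t <- allseqs (size l) (head 0 l)]
   | is_part t && subpart t l].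

Local Open Scope ring_scope.

Fixpoint He_pair (n : nat) : {poly rat} * {poly rat} :=
  match n with
  | 0 => (1, 'X)
  | n'.+1 => let: (a, b) := He_pair n' in (b, 'X * b - (n'.+1)%:R *: a)
  end.
Definition He (n : nat) : {poly rat} := (He_pair n).1.

Definition Wr (fs : seq {poly rat}) : {poly rat} :=
  \det (\matrix_(i < size fs, j < size fs) (nth 0 fs j)^`(i)).

Definition degvec (l : seq nat) : seq nat :=
  [seq (nth 0%N l i + size l - i.+1)%N | i <- iota 0 (size l)].

Definition Delta (l : seq nat) : rat :=
  \prod_(i < size l) \prod_(j < size l | (i < j)%N)
     (((nth 0%N (degvec l) j)%:R : rat) - (nth 0%N (degvec l) i)%:R).

Definition HeP (l : seq nat) : {poly rat} :=
  (Delta l)^-1 *: Wr [seq He n | n <- degvec l].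

Definition maya_shift (l : seq nat) (s : nat) : int -> bool :=
  fun m => (m < s%:Z) || (m \in [seq ((n + s)%N)%:Z | n <- degvec l]).

(* lambda(M), for a Maya diagram M given together with a window [lo, lo+n)
   such that every m < lo lies in M and no m >= lo + n lies in M:
   the parts are the positive values of #{x notin M : x < m}, m in M. *)
Definition lambda_of (M : int -> bool) (lo : int) (n : nat) : seq nat :=
  sort geq [seq p <- [seq count (fun j => ~~ M (lo + j%:Z)) (iota 0 i)
                      | i <- iota 0 n & M (lo + i%:Z)] | (0 < p)%N].

Definition phi_maya (mu nu : seq nat) (s s' : nat) : int -> bool :=
  fun m => if odd (absz m) then maya_shift nu s' (m %/ 2)%Z
           else maya_shift mu s (m %/ 2)%Z.

(* Phi(mu, nu, k), with the choice s, s' >= 0 minimal such that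
   l(nu) + s' - l(mu) - s = k. *)
Definition Phi (mu nu : seq nat) (k : int) : seq nat :=
  let e : int := k + (size mu)%:Z - (size nu)%:Z in
  let s := absz (Num.max 0 (- e)) in
  let s' := absz (Num.max 0 e) in
  lambda_of (phi_maya mu nu s s') 0
    (2 * (s + s' + sumn mu + sumn nu + size mu + size nu) + 2)%N.

Local Open Scope nat_scope.

Definition hdom (a b : seq nat) : bool :=
  has (fun i => (nth 0 a i == (nth 0 b i).+2) &&
       all (fun j => (j == i) || (nth 0 a j == nth 0 b j)) (iota 0 (size a)))
    (iota 0 (size a)).

Definition vdom (a b : seq nat) : bool :=
  has (fun i => [&& nth 0 a i == (nth 0 b i).+1,
                    nth 0 a i.+1 == (nth 0 b i.+1).+1,
                    nth 0 a i == nth 0 a i.+1 &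
       all (fun j => [|| j == i, j == i.+1 | nth 0 a j == nth 0 b j])
           (iota 0 (size a))])
    (iota 0 (size a)).

Fixpoint vchain (j : nat) (a b : seq nat) (v : nat) : bool :=
  match j with
  | 0 => (a == b) && (v == 0)
  | j'.+1 => has (fun c => (hdom a c && vchain j' c b v) ||
                           [&& vdom a c, 0 < v & vchain j' c b v.-1])
                 (subparts a)
  end.

(* ht_2(a/b) for b obtained from a by removing j dominoes: the number of
   vertical dominoes of some (here: the one with fewest) removal sequence;
   its parity is independent of the sequence. *)
Definition ht2 (j : nat) (a b : seq nat) : nat :=
  find (vchain j a b) (iota 0 j.+1).

Definition conjpart (l : seq nat) (j : nat) : nat := count (fun x => j < x) l.

(* hook length of the cell (i, j) (0-indexed, j < l_i) *)
Definition hook (l : seq nat) (i j : nat) : nat :=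
  (nth 0 l i - j) + (conjpart l j - i) - 1.

Definition Hodd (l : seq nat) : nat :=
  \prod_(i <- iota 0 (size l)) \prod_(j <- iota 0 (nth 0 l i) | odd (hook l i j))
     hook l i j.

Fixpoint nchains (n : nat) (a b : seq nat) : nat :=
  match n with
  | 0 => a == b
  | n'.+1 => \sum_(c <- subparts a | subpart b c && (sumn c == (sumn b).+1))
               nchains n' a c
  end.

Definition F (a b : seq nat) : nat := nchains (sumn a - sumn b) a b.

Definition F2 (mu nu mu' nu' : seq nat) : nat :=
  'C((sumn mu - sumn mu') + (sumn nu - sumn nu'), sumn mu - sumn mu')
  * F mu mu' * F nu nu'.

Definition pairs_lt (j : nat) (mu nu : seq nat) : seq (seq nat * seq nat) :=
  [seq p <- [seq (a, b) | a <- subparts mu, b <- subparts nu]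
   | sumn p.1 + sumn p.2 + j == sumn mu + sumn nu].

(* Main.v *)
Require Import Defs.
From HB Require Import structures.
From mathcomp Require Import all_boot all_order all_fingroup all_algebra.
From mathcomp Require Import zify ring.
Set Implicit Arguments. Unset Strict Implicit. Unset Printing Implicit Defensive.
Import Order.TTheory GRing.Theory Num.Theory.
Local Open Scope ring_scope.

(** Up to normalisation He_lambda is the Jacobi-Trudi determinant of the
    polynomials He_n / n!, indexed by the beads (degree vector) of lambda. Since
    n h_n - x h_n' = - h_(n-2) for h_n = He_n / n!, applying n - x d/dx to the
    determinant moves one bead down by two places in all possible ways. Listing the
    even beads before the odd ones, these moves are exactly the box removals in the
    2-quotient, without signs, so iterating gives the coefficient of x^(|lambda|-2j)
    as a sum over chains in the product of two Young lattices, with the leading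
    coefficients det (1/(n_i - j)!) at the end points. Up to sign the latter are
    inverse hook products by Vandermonde; the even hooks of lambda are twice the
    hooks of its quotient, and the same recursion for 1/n! in place of h_n is the
    hook length formula for the numbers of chains. The sign of a bead list counts
    inversions between even and odd beads, and such an inversion is created or
    destroyed exactly when a vertical domino is removed. *)

(** * Jacobi-Trudi determinants *)

(** Comparing coefficients of x^(2m + |core|) turns x d/dx into the exponent, so the core drops out
    and the factor in front is 2(|mu| + |nu| - m). It vanishes exactly at pairs of total size m:
    there the recursion stops, at a leading coefficient. With m = |mu| + |nu| - j the factors along
    any chain multiply to 2^j j!. Together with the factorials of N = |mu| + |nu| and N - j in the
    hook length formula this gives the binomial coefficient, and 2^j cancels against the powers 2^N
    and 2^(N-j) from the even hooks. No list of beads is reordered during the recursion: all pairs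
    use the same numbers a and a + k of even and odd beads, shorter partitions being padded with
    zero parts, and a move changes one entry in place. Sorting is needed only to compare with lambda
    itself, and there the sign cancels, because He_lambda is a determinant divided by its own
    leading coefficient. *)

Section JacobiTrudi.
Variable R : comNzRingType.
Implicit Types (u : nat -> R) (ns ms : seq nat).

Definition jt_entry u (n i : nat) : R := if (i <= n)%N then u (n - i)%N else 0.

Definition jtf u (L : nat) (n : nat -> nat) : R :=
  \det (\matrix_(i < L, j < L) jt_entry u (n j) i).

Definition jt u ns : R := jtf u (size ns) (nth 0%N ns).

Lemma jtE u ns L : size ns = L -> jt u ns = jtf u L (nth 0%N ns).
Proof. by move=> <-. Qed.

Lemma eq_jtf u L n m : (forall j, (j < L)%N -> n j = m j) -> jtf u L n = jtf u L m.
Proof. by move=> nm; congr (\det _); apply/matrixP => i j; rewrite !mxE nm. Qed.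

(** The first column is the first unit vector, and deleting the first row and column undoes the
    shift of the other beads. This is the effect of appending a zero part. *)
Lemma jt_cons0 u ns : u 0%N = 1 -> jt u (0%N :: map S ns) = jt u ns.
Proof.
move=> u0; rewrite (@jtE _ _ (size ns).+1) /= ?size_map // /jtf.
rewrite (expand_det_col _ ord0) big_ord_recl big1 => [|i _]; last first.
  by rewrite mxE /jt_entry /= mul0r.
rewrite addr0 mxE /jt_entry /= u0 mul1r /cofactor /= expr0 mul1r.
congr (\det _); apply/matrixP => i j; rewrite !mxE /= /bump /=.
by rewrite (nth_map 0%N) ?ltn_ord.
Qed.

(** Discards every bead move that lands on an occupied position. *)
Lemma jt_nuniq u ns : ~~ uniq ns -> jt u ns = 0.
Proof.
case/(uniqPn 0%N) => i [j] [ij js e].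
have is_ : (i < size ns)%N by apply: ltn_trans js.
rewrite /jt /jtf -det_tr.
apply: (determinant_alternate (i1 := Ordinal is_) (i2 := Ordinal js)).
  by rewrite -val_eqE /= neq_ltn ij.
by move=> k; rewrite !mxE /= e.
Qed.

(* Leibniz: both sides are sums over permutations, and on each permutation the
   weights [n_j - i] add up to the same number. *)
Lemma jtf_derivation u (d : R -> R) (w : R) (r L : nat) (n : nat -> nat) :
  {morph d : x y / x + y} -> (forall x y, d (x * y) = d x * y + x * d y) ->
  (forall m, m%:R * u m + d (u m) = w * jt_entry u m r) ->
  (\sum_(j < L) (n j)%:R - \sum_(i < L) (i : nat)%:R) * jtf u L n + d (jtf u L n) =
  w * \sum_(j < L) (if (r <= n j)%N then
        jtf u L (fun l => if l == j :> nat then (n j - r)%N else n l) else 0).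
Proof.
move=> dD dM du.
have d0 : d 0 = 0 by apply: (addrI (d 0)); rewrite -dD !addr0.
have d1 : d 1 = 0.
  by apply: (addrI (d 1)); rewrite -{3}[1]mulr1 dM mulr1 mul1r addr0.
have dN x : d (- x) = - d x.
  by apply/eqP; rewrite -subr_eq0 opprK -dD addNr d0.
have dS b x : d ((-1) ^+ b * x) = (-1) ^+ b * d x.
  have dX : d ((-1) ^+ b) = 0 by elim: b => [|b IH]; rewrite ?expr0 ?exprS ?mulN1r ?dN ?IH ?oppr0.
  by rewrite dM dX mul0r add0r.
have dsum (I : finType) (E : I -> R) : d (\sum_i E i) = \sum_i d (E i).
  exact: (big_morph d dD d0).
have dprod (I : finType) (E : I -> R) :
    d (\prod_i E i) = \sum_i d (E i) * \prod_(k | k != i) E k.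
  suff G (s : seq I) : uniq s -> d (\prod_(i <- s) E i) =
      \sum_(i <- s) d (E i) * \prod_(k <- s | k != i) E k.
    by rewrite /index_enum G // -enumT enum_uniq.
  elim: s => [|x s IH] /=; first by rewrite !big_nil d1.
  case/andP=> xs us; rewrite !big_cons dM IH // eqxx /=; congr (_ * _ + _).
    rewrite big_seq_cond [RHS]big_seq_cond; apply: eq_bigl => k.
    by case: eqP => [->|]; rewrite ?(negbTE xs) ?andbT.
  rewrite mulr_sumr big_seq [RHS]big_seq; apply: eq_bigr => i is_.
  rewrite big_cons; case: eqP => [e|_]; first by rewrite e is_ in xs.
  by rewrite mulrCA.
pose A i j := jt_entry u (n j) i.
(* With the weight n_j - i, the hypothesis on [u] turns the entry in row i into the one of the same
   column r rows further down. *)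
have key i j : ((n j)%:R - i%:R) * A i j + d (A i j) = w * jt_entry u (n j) (i + r).
  rewrite /A /jt_entry; case: leqP => ij; last first.
    by rewrite mulr0 d0 addr0 leqNgt (leq_trans ij) ?leq_addr //= mulr0.
  rewrite -natrB // du /jt_entry; congr (w * _); rewrite leq_subRL // subnDA.
  by [].
transitivity (\sum_(s : {perm 'I_L}) (-1) ^+ s *
   \sum_(i < L) w * jt_entry u (n (s i)) (i + r) * \prod_(k | k != i) A k (s k)).
  rewrite /jtf /determinant dsum mulr_sumr -big_split; apply: eq_bigr => s _ /=.
  rewrite dS mulrCA -mulrDr; congr (_ * _).
  rewrite dprod.
  have -> : \sum_(j < L) (n j)%:R = \sum_(i < L) (n (s i))%:R :> R.
    by rewrite (reindex_inj (@perm_inj _ s)).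
  rewrite -sumrB mulr_suml -big_split; apply: eq_bigr => i _ /=.
  rewrite -key [RHS]mulrDl !mxE; congr (_ + _); last first.
    by congr (_ * _); apply: eq_bigr => k _; rewrite mxE.
  rewrite (bigD1 i) //= !mxE mulrA; congr (_ * _).
  by apply: eq_bigr => k _; rewrite mxE.
(* When n_j < r the column read r rows further down is zero, since every row index i + r exceeds
   n_j; hence the value 0 in the statement. *)
have expand (j : 'I_L) : (if (r <= n j)%N then
     jtf u L (fun l => if l == j :> nat then (n j - r)%N else n l) else 0) =
   \det (\matrix_(i < L, l < L) (if l == j :> nat then jt_entry u (n j) (i + r) else A i l)).
  case: leqP => rn.
    rewrite /jtf; congr (\det _); apply/matrixP => i l; rewrite !mxE; case: eqP => // _.
    by rewrite /jt_entry leq_subRL // -subnDA [(r + i)%N]addnC.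
  apply/esym; rewrite -det_tr (expand_det_row _ j) big1 // => i _.
  by rewrite !mxE eqxx /jt_entry leqNgt (leq_trans rn) ?leq_addl ?mul0r.
under [X in _ = w * X]eq_bigr do rewrite expand.
rewrite mulr_sumr (eq_bigr (fun s : {perm 'I_L} => \sum_(i < L) w * ((-1) ^+ s *
   (jt_entry u (n (s i)) (i + r) * \prod_(k | k != i) A k (s k))))); last first.
  move=> s _; rewrite mulr_sumr; apply: eq_bigr => i _.
  by rewrite -mulrA mulrCA.
transitivity (\sum_(s : {perm 'I_L}) \sum_(j < L) w * ((-1) ^+ s *
   \prod_i (if s i == j then jt_entry u (n j) (i + r) else A i (s i)))).
  apply: eq_bigr => s _; rewrite [RHS](reindex_inj (@perm_inj _ s)).
  apply: eq_bigr => i _; congr (_ * (_ * _)).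
  rewrite [RHS](bigD1 i) //= eqxx; congr (_ * _); apply: eq_bigr => k ki.
  by rewrite (inj_eq perm_inj) (negbTE ki).
rewrite exchange_big; apply: eq_bigr => j _; rewrite -mulr_sumr; congr (_ * _).
by apply: eq_bigr => s _; congr (_ * _); apply: eq_bigr => i _; rewrite !mxE.
Qed.
End JacobiTrudi.

(** The sign is chosen before [R] and [u]: the determinants for He_n / n! and for 1 / n! must
    receive the same one, so that it cancels in their quotient. *)
Lemma jt_perm (ns ms : seq nat) : perm_eq ns ms -> exists b : bool,
  forall (R : comNzRingType) (u : nat -> R), jt u ns = (-1) ^+ b * jt u ms.
Proof.
move=> pe; have sz := perm_size pe.
have sns : size ns == size ms by rewrite sz.
have /tuple_permP [s e] : perm_eq (Tuple sns) (in_tuple ms) by [].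
exists (odd_perm s) => R u; rewrite mulrC -[_ ^+ _]det_perm -(det_tr (perm_mx s)) -det_mulmx.
rewrite (jtE _ sz) /jtf tr_perm_mx -col_permE.
congr (\det _); apply/matrixP => i j; rewrite !mxE.
congr (jt_entry _ _ _).
have -> : ns = [tuple tnth (in_tuple ms) (s i) | i < size ms] by [].
rewrite -[LHS]/(nth 0%N _ (j : nat)) -tnth_nth tnth_mktuple.
by rewrite (tnth_nth 0%N).
Qed.

(** * Hermite polynomials and the Vandermonde determinant *)

Lemma fact_neq0 n : (n`!)%:R != 0 :> rat.
Proof. by rewrite pnatr_eq0 -lt0n fact_gt0. Qed.

Lemma He_pairE n : He_pair n = (He n, He n.+1).
Proof. by rewrite /He /=; case: (He_pair n). Qed.

Lemma HeSS n : He n.+2 = 'X * He n.+1 - n.+1%:R *: He n.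
Proof. by rewrite {1}/He /= He_pairE. Qed.

Lemma He0 : He 0 = 1. Proof. by []. Qed.
Lemma He1 : He 1 = 'X. Proof. by []. Qed.

Lemma deriv_He n : (He n)^`() = n%:R *: He n.-1.
Proof.
suff [] : (He n)^`() = n%:R *: He n.-1 /\ (He n.+1)^`() = n.+1%:R *: He n by [].
elim: n => [|n [IH1 IH2]]; first by rewrite He0 He1 derivX derivC scale0r scale1r.
split=> //; rewrite HeSS derivB derivM derivX mul1r derivZ IH2 IH1.
case: n {IH1 IH2} => [|n]; first by rewrite He1 He0 scale0r scaler0 subr0 scale1r mulr1 -mulr2n scaler_nat.
rewrite (HeSS n) /= -!mul_polyC; move: (He n) (He n.+1) => p q.
rewrite -(natr1 n.+2) -(natr1 n.+1) !polyCD polyC1.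
by move: (n.+1%:R%:P) => c; ring.
Qed.

Definition He_div (n : nat) : {poly rat} := (n`!%:R)^-1 *: He n.
Definition fact_inv (n : nat) : rat := (n`!%:R)^-1.

(** He is an Appell sequence, He_n' = n He_(n-1), so the Wronskian matrix is the Jacobi-Trudi matrix
    with the column of n multiplied by n!. *)
Lemma derivn_He n i : (He n)^`(i) = n`!%:R *: jt_entry He_div n i.
Proof.
have -> : (He n)^`(i) = (n ^_ i)%:R *: He (n - i).
  elim: i => [|i IH]; first by rewrite derivn0 ffactn0 scale1r subn0.
  by rewrite derivnS IH derivZ deriv_He scalerA -natrM ffactnSr subnS.
rewrite /jt_entry; case: leqP => ni; last by rewrite ffact_small // scale0r scaler0.
rewrite /He_div scalerA; congr (_ *: _).
by rewrite -(ffact_fact ni) natrM mulfK ?fact_neq0.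
Qed.

Lemma size_He n : (size (He n) <= n.+1)%N.
Proof.
suff [] : (size (He n) <= n.+1)%N /\ (size (He n.+1) <= n.+2)%N by [].
elim: n => [|n [IH1 IH2]]; first by rewrite He0 He1 size_poly1 size_polyX.
split=> //; rewrite HeSS (leq_trans (size_polyD _ _)) // geq_max size_polyN.
rewrite (leq_trans (size_scale_leq _ _)) ?andbT; last by rewrite (leq_trans IH1) // leqW.
by rewrite (leq_trans (size_polyMleq _ _)) // size_polyX.
Qed.

Lemma lead_He n : (He n)`_n = 1.
Proof.
suff [] : (He n)`_n = 1 /\ (He n.+1)`_n.+1 = 1 by [].
elim: n => [|n [IH1 IH2]]; first by rewrite He0 He1 coefX coef1.
split=> //; rewrite HeSS coefB coefXM /= IH2 coefZ nth_default ?mulr0 ?subr0 //.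
by rewrite (leq_trans (size_He n)).
Qed.

Lemma He_div_rec n : n%:R * He_div n + - ('X * (He_div n)^`()) = (-1) * jt_entry He_div n 2.
Proof.
rewrite /jt_entry /He_div derivZ deriv_He.
case: n => [|[|n]] /=.
- by rewrite scale0r scaler0 mulr0 oppr0 addr0 mul0r mulr0.
- by rewrite He0 He1 invr1 !scale1r mulr1 mul1r subrr mulr0.
rewrite !subSS subn0 HeSS !factS !natrM -!mul_polyC -!polyC_natr.
have h1 := fact_neq0 n; have h2 : n.+1%:R != 0 :> rat by rewrite pnatr_eq0.
have h3 : n.+2%:R != 0 :> rat by rewrite pnatr_eq0.
move: (He n) (He n.+1) => p q.
have e x y : x *: (y : {poly rat}) = x%:P * y by rewrite mul_polyC.
set a : rat := (_ * _)^-1.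
have e1 : n.+2%:R * a * n.+1%:R = (n`!)%:R^-1 :> rat.
  rewrite /a; move: h1 h2 h3; move: (n`!%:R) (n.+1%:R) (n.+2%:R) => x y z h1 h2 h3.
  by field; rewrite h1 h2 h3.
by rewrite -e1 !polyCM; ring.
Qed.

(** The hypothesis of [jtf_derivation] for the derivation 0, w = 1 and r = 1; [He_div_rec] is the
    one for - x d/dx, w = -1 and r = 2. *)
Lemma fact_inv_rec n : n%:R * fact_inv n + 0 = 1 * jt_entry fact_inv n 1.
Proof.
rewrite /jt_entry /fact_inv; case: n => [|n] /=; first by ring.
by rewrite subn1 /= factS natrM addr0 mul1r invfM mulrA divff ?mul1r // pnatr_eq0.
Qed.

Lemma coef_prod_top (I : Type) (s : seq I) (E : I -> {poly rat}) (d : I -> nat) :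
  (forall i, size (E i) <= (d i).+1)%N ->
  (\prod_(i <- s) E i)`_(\sum_(i <- s) d i) = \prod_(i <- s) (E i)`_(d i) /\
  (size (\prod_(i <- s) E i)%R <= (\sum_(i <- s) d i).+1)%N.
Proof.
move=> sE; elim: s => [|x s [IH1 IH2]]; first by rewrite !big_nil coef1 size_poly1.
rewrite !big_cons; split; last first.
  rewrite (leq_trans (size_polyMleq _ _)) //.
  by have := leq_add (sE x) IH2; lia.
rewrite coefM -IH1 (bigD1 (inord (d x))) //= inordK; last by lia.
rewrite addKn [X in _ + X]big1 ?addr0 // => i; rewrite -val_eqE /= inordK; last by lia.
move=> ni; case: (ltngtP i (d x)) ni => // h _.
  rewrite [X in _ * X]nth_default ?mulr0 // (leq_trans IH2) //.
  by have := ltn_ord i; lia.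
by rewrite [X in X * _]nth_default ?mul0r // (leq_trans (sE x)).
Qed.

Lemma sum_ord_bin L : (\sum_(i < L) i = 'C(L, 2))%N.
Proof. by rewrite -(big_mkord xpredT id) bin2_sum. Qed.

(** Every nonzero Leibniz product has degree at most the sum of n_(s i) - i, which does not depend
    on s; its coefficient there is the product of the 1 / (n_(s i) - i)! because He_n is monic. *)
Lemma lead_jt_He ns :
  (jt He_div ns)`_(sumn ns - 'C(size ns, 2)) = jt fact_inv ns.
Proof.
rewrite /jt /jtf /determinant coef_sum; apply: eq_bigr => s _.
have sgn (b : bool) (p : {poly rat}) m : ((-1) ^+ b * p)`_m = (-1) ^+ b * p`_m.
  by case: b; rewrite ?expr1 ?expr0 ?mulN1r ?coefN ?mul1r.
rewrite sgn; congr (_ * _).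
(* If a row index exceeds its bead, both products contain a zero entry. Otherwise the truncated
   subtractions below are exact. *)
have [/forallP /= ok|] := boolP [forall i : 'I_(size ns), (i <= nth 0 ns (s i))%N]; last first.
  rewrite negb_forall => /existsP [i]; rewrite -ltnNge => h.
  by rewrite (bigD1 i) // [RHS](bigD1 i) //= !mxE /jt_entry leqNgt h !mul0r coef0.
have -> : (sumn ns - 'C(size ns, 2) = \sum_(i < size ns) (nth 0 ns (s i) - i))%N.
  rewrite sumnB // sum_ord_bin; congr (_ - _)%N.
  by rewrite sumnE (big_nth 0%N) big_mkord (reindex_inj (@perm_inj _ s)).
have [i|-> _] := @coef_prod_top _ (index_enum 'I_(size ns))
  (fun i => (\matrix_(i < size ns, j < size ns) jt_entry He_div (nth 0%N ns j) i) i (s i))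
  (fun i => (nth 0 ns (s i) - i)%N).
  rewrite mxE /jt_entry ok (leq_trans (size_scale_leq _ _)) //.
  exact: size_He.
by apply: eq_bigr => i _; rewrite !mxE /jt_entry ok coefZ lead_He mulr1.
Qed.

Fixpoint vdm (ns : seq nat) : rat :=
  if ns is x :: s then (\prod_(y <- s) (y%:R - x%:R)) * vdm s else 1.

Lemma vdmE ns : vdm ns =
  \prod_(i < size ns) \prod_(j < size ns | (i < j)%N) ((nth 0%N ns j)%:R - (nth 0%N ns i)%:R).
Proof.
elim: ns => [|x s IH]; first by rewrite big_ord0.
rewrite /= big_ord_recl IH; congr (_ * _).
  by rewrite [RHS]big_mkcond big_ord_recl /= mul1r (big_nth 0%N) big_mkord.
by apply: eq_bigr => i _; rewrite [RHS]big_mkcond big_ord_recl /= mul1r -big_mkcond.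
Qed.

(* The falling factorials [n_j^_i] are values of monic polynomials of degree [i]
   at [n_j], so their determinant is that of Vandermonde. *)
Lemma jt_fact_inv ns : jt fact_inv ns = vdm ns / \prod_(n <- ns) (n`!)%:R.
Proof.
set L := size ns.
pose a : 'rV[rat]_L := \row_j (nth 0%N ns j)%:R.
pose p (i : nat) : {poly rat} := \prod_(k < i) ('X - (k%:R)%:P).
have sp i : size (p i) = i.+1 by rewrite size_prod_XsubC /index_enum -enumT size_enum_ord.
have pE (n i : nat) : (p i).[n%:R] = (n ^_ i)%:R.
  elim: i => [|i IH]; first by rewrite /p big_ord0 hornerC ffactn0.
  rewrite /p big_ord_recr /= hornerM -/(p i) IH ffactnSr natrM hornerXsubC.
  have [h|h] := leqP i n; first by rewrite natrB.
  by rewrite ffact_small // !mul0r.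
pose T : 'M[rat]_L := \matrix_(i, k) (p i)`_k.
pose Q : 'M[rat]_L := diag_mx (\row_j ((nth 0%N ns j)`!%:R)^-1).
have -> : jt fact_inv ns = \det (T *m Vandermonde L a *m Q).
  congr (\det _); apply/matrixP => i j; rewrite mul_mx_diag !mxE.
  have -> : \sum_k T i k * Vandermonde L a k j = (nth 0%N ns j ^_ i)%:R.
    rewrite -pE (horner_coef_wide (n := L)) ?sp ?ltn_ord //.
    by apply: eq_bigr => k _; rewrite !mxE.
  rewrite /jt_entry /fact_inv; case: leqP => h; last by rewrite ffact_small // mul0r.
  rewrite -(ffact_fact h) natrM invfM mulrA divff ?mul1r // pnatr_eq0 -lt0n ffact_gt0 h.
  by [].
rewrite !det_mulmx det_Vandermonde det_diag vdmE; congr (_ * _).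
  rewrite det_trig; last first.
    by apply/is_trig_mxP => i k ik; rewrite mxE nth_default // sp.
  rewrite big1 ?mul1r => [|i _]; last first.
    rewrite mxE; have := monic_prod_XsubC (index_enum 'I_i) xpredT (fun k => k%:R : rat).
    by rewrite -/(p i) => /monicP; rewrite /lead_coef sp.
  by apply: eq_bigr => i _; apply: eq_bigr => j _; rewrite !mxE.
rewrite [in RHS](big_nth 0%N) big_mkord -prodfV.
by apply: eq_bigr => i _; rewrite mxE.
Qed.

Lemma size_degvec l : size (degvec l) = size l.
Proof. by rewrite size_map size_iota. Qed.

(** Pulling n! out of each column of the Wronskian leaves Delta / prod n! as divisor, which is the
    determinant for 1 / n!. *)
Lemma HePE l : HeP l = (jt fact_inv (degvec l))^-1 *: jt He_div (degvec l).
Proof.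
set ns := degvec l.
have -> : HeP l = (Delta l)^-1 *: ((\prod_(n <- ns) (n`!)%:R) *: jt He_div ns).
  congr (_ *: _); rewrite /Wr /jt /jtf.
  set L := size ns; rewrite size_map.
  pose Q : 'M[{poly rat}]_L := diag_mx (\row_j ((nth 0%N ns j)`!%:R)%:P).
  transitivity (\det (\matrix_(i < L, j < L) jt_entry He_div (nth 0%N ns j) i *m Q)).
    congr (\det _); apply/matrixP => i j; rewrite mul_mx_diag !mxE.
    by rewrite (nth_map 0%N) ?ltn_ord // derivn_He mulrC mul_polyC.
  rewrite det_mulmx det_diag mulrC -mul_polyC (big_nth 0%N) big_mkord rmorph_prod.
  by congr (_ * _); apply: eq_bigr => i _; rewrite mxE.
have -> : Delta l = vdm ns by rewrite vdmE /Delta /ns size_degvec.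
rewrite jt_fact_inv scalerA invf_div mulrC.
by congr (_ *: _); rewrite mulrC.
Qed.

(** * Partitions and beads *)

Local Open Scope nat_scope.

Lemma geq_trans : transitive geq.
Proof. by move=> y x z /= xy yz; apply: leq_trans xy. Qed.

Lemma gtn_trans : transitive gtn.
Proof. by move=> y x z /= xy yz; apply: ltn_trans xy. Qed.

Lemma sorted_geq_nth (t : seq nat) i j :
  sorted geq t -> i <= j -> nth 0 t j <= nth 0 t i.
Proof.
move=> st ij; have [jt|jt] := ltnP j (size t); last by rewrite (nth_default _ jt).
apply: (sorted_leq_nth geq_trans leqnn 0 st) => //; rewrite inE //.
exact: leq_ltn_trans jt.
Qed.

Lemma part_nth l i j : is_part l -> i <= j -> nth 0 l j <= nth 0 l i.
Proof. by case/andP=> sl _; apply: sorted_geq_nth. Qed.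

Lemma part_pos l i : is_part l -> (0 < nth 0 l i) = (i < size l).
Proof.
case/andP=> _ /(all_nthP 0) al; have [h|h] := ltnP i (size l); first exact: al.
by rewrite nth_default.
Qed.

(** The default 0 of [nth] pads with zero parts, and positivity of the parts recovers the length. *)
Lemma part_ext l m : is_part l -> is_part m -> nth 0 l =1 nth 0 m -> l = m.
Proof.
move=> pl pm e; apply: (@eq_from_nth _ 0) => //.
apply/eqP; rewrite eqn_leq leqNgt -(part_pos _ pl) e nth_default //=.
by rewrite leqNgt -(part_pos _ pm) -e nth_default.
Qed.

Lemma nth_filter_pos t i : sorted geq t -> nth 0 (filter (fun x => 0 < x) t) i = nth 0 t i.
Proof.
elim: t i => [|x t IH] i //= st.
case: (posnP x) => [x0|x0]; last first.
  by case: i => [|i] //=; rewrite IH // (path_sorted st).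
have t0 k : nth 0 (x :: t) k = 0.
  by apply/eqP; rewrite -leqn0; have := @sorted_geq_nth (x :: t) _ _ st (leq0n k); rewrite [nth 0 _ 0]x0.
rewrite t0 (eq_in_filter (a2 := pred0)) ?filter_pred0 ?nth_nil //.
move=> y /(nthP 0) [k _ <-]; by rewrite -[nth 0 t k]/(nth 0 (x :: t) k.+1) t0.
Qed.

Lemma is_part_filter t : sorted geq t -> is_part (filter (fun x => 0 < x) t).
Proof.
by move=> st; rewrite /is_part (sorted_filter geq_trans) //= filter_all.
Qed.

Lemma subpartP a b : is_part a -> is_part b ->
  reflect (forall i, nth 0 a i <= nth 0 b i) (subpart a b).
Proof.
move=> pa pb; apply: (iffP andP) => [[s /allP al] i|le].
  have [h|h] := ltnP i (size a); last by rewrite nth_default.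
  by apply: al; rewrite mem_iota.
split; last by apply/allP => i _; apply: le.
by rewrite leqNgt -(part_pos _ pa) -leqNgt (leq_trans (le _)) // nth_default.
Qed.

Lemma mem_allseqs n m t :
  (t \in allseqs n m) = (size t == n) && all (fun x => x <= m) t.
Proof.
elim: n t => [|n IH] t; first by case: t.
cbn [allseqs]; apply/flattenP/andP => [[s /mapP [x]]|[]].
  rewrite mem_iota /= add0n ltnS => xm -> /mapP [u]; rewrite IH => /andP [su ua] ->.
  by rewrite /= eqSS su xm.
case: t => [|y t] //; rewrite [size _]/= [all _ _]/= eqSS => st /andP [ym al].
exists [seq y :: u | u <- allseqs n m].
  by apply/mapP; exists y => //; rewrite mem_iota.
by apply/mapP; exists t; rewrite // IH st.
Qed.

Lemma mem_subparts l c : is_part l ->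
  (c \in subparts l) = is_part c && subpart c l.
Proof.
move=> pl; rewrite mem_filter mem_undup.
apply/andP/idP => [[] //|/[dup] pcl /andP [pc sc]]; split=> //.
move/(subpartP pc pl): (sc) => le; case/andP: sc => sz _.
(* [allseqs] lists only sequences of the full length of [l], so [c] is padded with zeros, which the
   filter strips again. *)
pose t := mkseq (nth 0 c) (size l).
have st : sorted geq t.
  apply/(sortedP 0) => i; rewrite size_mkseq => h; rewrite !nth_mkseq //; last by lia.
  exact: part_nth.
apply/mapP; exists t.
  rewrite mem_allseqs size_mkseq eqxx /=; apply/allP => x /mapP [i _ ->].
  by rewrite (leq_trans (le i)) // -nth0 part_nth.
apply: part_ext => // [|i]; first exact: is_part_filter.
rewrite nth_filter_pos //; have [h|h] := ltnP i (size l); first by rewrite nth_mkseq.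
by rewrite !nth_default ?size_mkseq // (leq_trans sz).
Qed.

Lemma uniq_subparts l : uniq (subparts l).
Proof. by rewrite filter_uniq ?undup_uniq. Qed.

Lemma subpart_refl a : subpart a a.
Proof. by rewrite /subpart leqnn; apply/allP. Qed.

Lemma subpart_trans a b c : is_part a -> is_part b -> is_part c ->
  subpart a b -> subpart b c -> subpart a c.
Proof.
move=> pa pb pc /(subpartP pa pb) ab /(subpartP pb pc) bc.
by apply/(subpartP pa pc) => i; apply: leq_trans (bc i).
Qed.

Lemma sumn_nth l L : size l <= L -> sumn l = \sum_(i < L) nth 0 l i.
Proof.
move=> sl; rewrite sumnE (big_nth 0) big_mkord (big_ord_widen L) //.
by rewrite big_mkcond; apply: eq_bigr => i _; case: ltnP => // h; rewrite nth_default.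
Qed.

Lemma subpart_sumn a b : is_part a -> is_part b -> subpart a b -> sumn a <= sumn b.
Proof.
move=> pa pb /[dup] /(subpartP pa pb) le /andP [sz _].
by rewrite (sumn_nth sz) (sumn_nth (leqnn _)) leq_sum.
Qed.

Lemma sum_nat_D1 L (f : nat -> nat) (j : 'I_L) :
  \sum_(i < L) f i = f j + \sum_(i < L | i != j) f i.
Proof. exact: bigD1. Qed.

Lemma subpart_eq a b : is_part a -> is_part b -> subpart a b -> sumn b <= sumn a -> a = b.
Proof.
move=> pa pb /[dup] /(subpartP pa pb) le /andP [sz _] sl.
apply: part_ext => // i; apply/eqP; rewrite eqn_leq le /=.
have [h|h] := ltnP i (size b); last by rewrite (nth_default _ h).
move: sl; rewrite (sumn_nth sz) (sumn_nth (leqnn _)) !(sum_nat_D1 _ (Ordinal h)) => sl.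
have : \sum_(k < size b | k != Ordinal h) nth 0 a k <=
  \sum_(k < size b | k != Ordinal h) nth 0 b k by apply: leq_sum.
by move/(leq_add (leqnn (nth 0 a i)))/(leq_trans sl); rewrite leq_add2r.
Qed.

(** The beta-set with [L] beads, [l] being padded with zero parts. A free [L] gives all partitions
    inside a given one the same number of beads. *)
Definition beads (L : nat) (l : seq nat) : seq nat :=
  [seq nth 0 l i + L - i.+1 | i <- iota 0 L].

Lemma size_beads L l : size (beads L l) = L.
Proof. by rewrite size_map size_iota. Qed.

Lemma nth_beads L l i : i < L -> nth 0 (beads L l) i = nth 0 l i + (L - i.+1).
Proof.
by move=> h; rewrite (nth_map 0) ?size_iota // nth_iota // add0n addnBA.
Qed.

Lemma degvecE l : degvec l = beads (size l) l.
Proof. by []. Qed.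

Lemma sorted_beads L l : is_part l -> sorted gtn (beads L l).
Proof.
move=> pl; apply/(sortedP 0) => i; rewrite size_beads => h.
rewrite !nth_beads //=; last by lia.
by have := part_nth pl (leqnSn i); lia.
Qed.

Lemma gtn_sorted_uniq s : sorted gtn s -> uniq s.
Proof. by apply: sorted_uniq; [exact: gtn_trans | exact: ltnn]. Qed.

Lemma uniq_beads L l : is_part l -> uniq (beads L l).
Proof. by move=> pl; apply: gtn_sorted_uniq; apply: sorted_beads. Qed.

Lemma beads_inj L l m : is_part l -> is_part m -> size l <= L -> size m <= L ->
  beads L l = beads L m -> l = m.
Proof.
move=> pl pm sl sm e; apply: part_ext => // i.
have [h|h] := ltnP i L; last by rewrite !nth_default // (leq_trans _ h).
by have := congr1 (fun s => nth 0 s i) e; rewrite !nth_beads // => /addIn.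
Qed.

Lemma sorted_gtn_nth (s : seq nat) i j :
  sorted gtn s -> i < j < size s -> nth 0 s j < nth 0 s i.
Proof.
move=> st /andP [ij js]; apply: (sorted_ltn_nth gtn_trans 0 st) => //.
by rewrite inE (ltn_trans ij).
Qed.

(** A strictly decreasing list of length n has s_i >= n - i - 1, so subtracting the staircase loses
    nothing. *)
Lemma beads_surj s : sorted gtn s ->
  exists l, [/\ is_part l, size l <= size s & beads (size s) l = s].
Proof.
move=> st; pose t := mkseq (fun i => nth 0 s i - (size s - i.+1)) (size s).
have lb i : i < size s -> size s - i.+1 <= nth 0 s i.
  suff G k : i + k.+1 = size s -> k <= nth 0 s i by move=> h; apply: G; lia.
  elim: k i => // k IH i ek; have lt : i < i.+1 < size s by lia.
  by apply: leq_ltn_trans (sorted_gtn_nth st lt); apply: IH; lia.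
have gt : sorted geq t.
  apply/(sortedP 0) => i; rewrite size_mkseq => h; rewrite !nth_mkseq //=; last by lia.
  have lt : i < i.+1 < size s by lia.
  by have := sorted_gtn_nth st lt; lia.
exists (filter (fun x => 0 < x) t); split; first exact: is_part_filter.
  by rewrite size_filter (leq_trans (count_size _ _)) // size_mkseq.
apply: (@eq_from_nth _ 0); rewrite size_beads // => i h.
by rewrite nth_beads // nth_filter_pos // nth_mkseq // subnK ?lb.
Qed.

Lemma sumn_beads L l : size l <= L -> sumn (beads L l) = sumn l + 'C(L, 2).
Proof.
move=> sl; rewrite sumnE (big_nth 0) size_beads big_mkord.
rewrite (eq_bigr (fun i : 'I_L => nth 0 l i + (L - i.+1))) => [|i _]; last exact: nth_beads.
rewrite big_split /= -sumn_nth //; congr (_ + _).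
by rewrite -sum_ord_bin [RHS](reindex_inj rev_ord_inj).
Qed.

Lemma sum_unit_diff L (f g : nat -> nat) :
  (forall i, i < L -> f i <= g i) -> \sum_(i < L) g i = (\sum_(i < L) f i).+1 ->
  exists j, [/\ j < L, g j = (f j).+1 & forall i, i < L -> i != j -> f i = g i].
Proof.
move=> le e.
have [/existsP [j fg]|] := boolP [exists j : 'I_L, f j < g j]; last first.
  rewrite negb_exists => /forallP h; suff: \sum_(i < L) g i <= \sum_(i < L) f i by lia.
  by apply: leq_sum => i _; rewrite leqNgt h.
exists j; rewrite ltn_ord; move: e; rewrite !(sum_nat_D1 _ j) => e.
have le1 : \sum_(i < L | i != j) f i <= \sum_(i < L | i != j) g i.
  by apply: leq_sum => i _; apply: le.
have eqj : g j = (f j).+1.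
  by move: e le1; move: (\sum_(_ < _ | _) _) (\sum_(_ < _ | _) _) => x y; lia.
split=> // i iL ij; apply/eqP; rewrite eqn_leq le //=.
have ij' : Ordinal iL != j by rewrite -val_eqE.
move: e; rewrite eqj addSn => -[] /addnI.
rewrite (bigD1 (Ordinal iL)) // [RHS](bigD1 (Ordinal iL)) //= => e'.
have le2 : \sum_(k < L | (k != j) && (k != Ordinal iL)) f k
  <= \sum_(k < L | (k != j) && (k != Ordinal iL)) g k.
  by apply: leq_sum => k _; apply: le.
by rewrite -(leq_add2r (\sum_(k < L | (k != j) && (k != Ordinal iL)) f k)) -e' leq_add2l.
Qed.

Definition decr (r : nat) (ns : seq nat) (j : nat) : seq nat :=
  set_nth 0 ns j (nth 0 ns j - r).

Definition covered (l : seq nat) : seq (seq nat) :=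
  [seq c <- subparts l | (sumn c).+1 == sumn l].

Lemma mem_covered l c : is_part l ->
  (c \in covered l) = [&& is_part c, subpart c l & (sumn c).+1 == sumn l].
Proof. by move=> pl; rewrite mem_filter mem_subparts // andbC andbA. Qed.

(** Removing a box lowers one bead by one. Conversely, lowering a positive bead keeps the list
    decreasing unless it meets the next bead, which distinctness excludes. *)
Lemma beads_covered L l : is_part l -> size l <= L ->
  perm_eq [seq beads L c | c <- covered l]
    [seq decr 1 (beads L l) j
       | j <- iota 0 L & (0 < nth 0 (beads L l) j) && uniq (decr 1 (beads L l) j)].
Proof.
move=> pl sl; set s := beads L l.
have sz_decr j : j < L -> size (decr 1 s j) = L.
  by move=> jL; rewrite size_set_nth size_beads; apply/maxn_idPr.
have nthd j i : nth 0 (decr 1 s j) i = if i == j then nth 0 s j - 1 else nth 0 s i.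
  by rewrite nth_set_nth.
apply: uniq_perm.
- rewrite map_inj_in_uniq => [|c d]; first by rewrite filter_uniq // uniq_subparts.
  rewrite !mem_covered // => /and3P [pc /andP [sc _] _] /and3P [pd /andP [sd _] _].
  by apply: beads_inj => //; apply: leq_trans sl.
- rewrite map_inj_in_uniq ?filter_uniq ?iota_uniq // => i j.
  rewrite !mem_filter => /andP [/andP [i0 _] _] _ e.
  apply/eqP/negPn/negP => ij; have := congr1 (fun t => nth 0 t i) e.
  by rewrite !nthd eqxx (negbTE ij); lia.
move=> t; apply/mapP/mapP => -[].
  move=> c; rewrite mem_covered // => /and3P [pc cl /eqP e] ->.
  move: (cl) => /andP [szc _].
  have szL := leq_trans szc sl.
  have [||j [jL e1 e2]] := @sum_unit_diff L (nth 0 c) (nth 0 l).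
  - by move=> i _; move: i; apply/subpartP.
  - by rewrite -!sumn_nth // e.
  have be : beads L c = decr 1 s j.
    apply: (@eq_from_nth _ 0); rewrite size_beads ?sz_decr // => i iL.
    rewrite nthd /s !nth_beads //; case: eqP => [->|/eqP ij]; first by rewrite e1; lia.
    by rewrite e2.
  exists j => //; rewrite mem_filter mem_iota /= jL -be uniq_beads // !andbT.
  by rewrite nth_beads // e1.
move=> j; rewrite mem_filter mem_iota /= add0n => /andP [/andP [j0 ud] jL] ->.
have ss := sorted_beads L pl; rewrite -/s in ss.
have sd : sorted gtn (decr 1 s j).
  apply/(sortedP 0) => i; rewrite sz_decr // => iL; rewrite !nthd /=.
  have := @sorted_gtn_nth s i i.+1 ss; rewrite size_beads ltnSn iL => /(_ isT) h.
  case: (eqVneq i.+1 j) => [e|ij]; first by rewrite -e (_ : (i == i.+1) = false); lia.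
  case: (eqVneq i j) => [e|//]; subst j.
  suff: nth 0 s i.+1 != nth 0 s i - 1 by lia.
  have := nth_uniq 0 (_ : i.+1 < size (decr 1 s i)) (_ : i < size (decr 1 s i)) ud.
  rewrite !sz_decr // !nthd eqxx (negbTE ij) => -> //.
have [c [pc sc]] := beads_surj sd; rewrite sz_decr // in sc * => bc.
exists c => //; rewrite mem_covered // pc /=.
have cn i : i < L -> nth 0 c i <= nth 0 l i.
  move=> iL; have := congr1 (fun t => nth 0 t i) bc.
  by rewrite /s nth_beads // nthd !nth_beads //; case: eqP => [->|]; lia.
apply/andP; split.
  apply/(subpartP pc pl) => i; have [iL|iL] := ltnP i L; first exact: cn.
  by rewrite nth_default // (leq_trans sc).
have : sumn (beads L c) + 1 = sumn s.
  rewrite bc (@sumn_nth (decr 1 s j) L) ?sz_decr // (@sumn_nth s L) ?size_beads //.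
  rewrite !(sum_nat_D1 _ (Ordinal jL)) nthd eqxx addnAC subnK //; congr (_ + _).
  by apply: eq_bigr => i; rewrite -val_eqE nthd => /negbTE ->.
by rewrite /s !sumn_beads //; lia.
Qed.

Local Open Scope ring_scope.

Lemma sum_covered (R : nmodType) (T : seq nat -> R) L l : is_part l -> (size l <= L)%N ->
  (forall s, ~~ uniq s -> T s = 0) ->
  \sum_(j < L) (if (0 < nth 0%N (beads L l) j)%N then T (decr 1 (beads L l) j) else 0) =
  \sum_(c <- covered l) T (beads L c).
Proof.
move=> pl sl T0.
rewrite -(big_map (beads L) xpredT T) (perm_big _ (beads_covered pl sl)) big_map big_filter.
rewrite [RHS]big_mkcond -(big_mkord xpredT (fun j => if (0 < nth 0%N (beads L l) j)%N then
  T (decr 1 (beads L l) j) else 0)).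
rewrite /index_iota subn0; apply: eq_bigr => j _; case: (0 < _)%N => //=.
by case: ifPn => // /T0.
Qed.

(** * Chains of partitions *)

Local Open Scope nat_scope.

Lemma F_refl a : F a a = 1.
Proof. by rewrite /F subnn /= eqxx. Qed.

Definition covers (mu m : seq nat) : seq (seq nat) :=
  [seq c <- subparts mu | subpart m c && (sumn c == (sumn m).+1)].

Lemma F_rec a b : sumn b < sumn a -> F a b = \sum_(c <- covers a b) F a c.
Proof.
move=> lt; rewrite /F -[sumn a - sumn b]prednK ?subn_gt0 //= big_filter.
by apply: eq_bigr => c /andP [_ /eqP ->]; rewrite subnS.
Qed.

Lemma covers_nil a b : is_part a -> is_part b -> sumn a <= sumn b -> covers a b = [::].
Proof.
move=> pa pb le; apply/eqP; rewrite -(negbK (_ == _)) -has_filter; apply/hasPn => c.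
rewrite mem_subparts // => /andP [pc ca]; rewrite negb_and; apply/orP; right.
by have := subpart_sumn pc pa ca; lia.
Qed.

(** The lowest step of a chain adds a box to [m] or to [n]; the binomial coefficients obey Pascal's
    rule. *)
Lemma F2_rec mu nu m n :
  is_part mu -> is_part nu -> is_part m -> is_part n -> subpart m mu -> subpart n nu ->
  sumn m + sumn n < sumn mu + sumn nu ->
  F2 mu nu m n = \sum_(c <- covers mu m) F2 mu nu c n + \sum_(d <- covers nu n) F2 mu nu m d.
Proof.
move=> pmu pnu pm pn sm sn lt.
have lm := subpart_sumn pm pmu sm; have ln := subpart_sumn pn pnu sn.
(* The 0/1 factor is essential: once [m] has reached the size of [mu] there is no cover, but the
   binomial coefficient with truncated predecessor is 1. *)
have e1 : \sum_(c <- covers mu m) F2 mu nu c n =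
    (sumn m < sumn mu) * ('C((sumn mu - sumn m).-1 + (sumn nu - sumn n), (sumn mu - sumn m).-1)
      * F mu m * F nu n).
  case: ltnP => h; last by rewrite covers_nil // big_nil.
  rewrite mul1n F_rec // big_distrr big_distrl [LHS]big_seq [RHS]big_seq; apply: eq_bigr => c.
  by rewrite mem_filter => /andP [/andP [_ /eqP ec] _]; rewrite /F2 ec subnS.
have e2 : \sum_(d <- covers nu n) F2 mu nu m d =
    (sumn n < sumn nu) * ('C((sumn mu - sumn m) + (sumn nu - sumn n).-1, (sumn mu - sumn m))
      * F mu m * F nu n).
  case: ltnP => h; last by rewrite covers_nil // big_nil.
  rewrite mul1n [F nu n]F_rec // big_distrr [LHS]big_seq [RHS]big_seq; apply: eq_bigr => c.
  by rewrite mem_filter => /andP [/andP [_ /eqP ec] _]; rewrite /F2 ec subnS.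
rewrite e1 e2 /F2 -!(subn_gt0 (sumn _)).
move: (F mu m) (F nu n) => f g.
have : 0 < (sumn mu - sumn m) + (sumn nu - sumn n) by lia.
case: (sumn mu - sumn m) (sumn nu - sumn n) => [|x] [|y] //= _.
- by rewrite mul0n mul1n !add0n !bin0.
- by rewrite mul0n mul1n !addn0 !binn.
by rewrite !mul1n !addSn !addnS binS !mulnDl addnC.
Qed.

Local Open Scope ring_scope.

Lemma big_pairs_lt (R : nmodType) j mu nu (T : seq nat -> seq nat -> R) :
  \sum_(p <- pairs_lt j mu nu) T p.1 p.2 =
  \sum_(a <- subparts mu) \sum_(b <- subparts nu | (sumn a + sumn b + j == sumn mu + sumn nu)%N)
    T a b.
Proof.
rewrite big_filter big_mkcond big_allpairs_dep; apply: eq_bigr => a _.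
by rewrite -big_mkcond.
Qed.

Lemma sum_covered_in (R : nmodType) mu a (T : seq nat -> R) :
  is_part mu -> a \in subparts mu ->
  \sum_(c <- covered a) T c = \sum_(c <- subparts mu | subpart c a && (sumn a == (sumn c).+1)) T c.
Proof.
move=> pmu; rewrite mem_subparts // => /andP [pa sa].
rewrite -[RHS]big_filter; apply/perm_big/uniq_perm.
- by rewrite filter_uniq // uniq_subparts.
- by rewrite filter_uniq // uniq_subparts.
move=> c; rewrite mem_covered // mem_filter mem_subparts // eq_sym.
apply/and3P/and3P => [[pc ca ->]|[/andP [ca ->] pc _]].
  by split=> //; rewrite ?ca // (subpart_trans pc pa).
by [].
Qed.

(* Unfolding the recursion [j] times sums [T] over the chains of length [j] going
   down from [(mu, nu)]; these are grouped by their end points. *)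
Lemma iterate_chains (mu nu : seq nat) (T : seq nat -> seq nat -> rat) (w : rat) (M : nat) :
  is_part mu -> is_part nu ->
  (forall a b, is_part a -> is_part b -> subpart a mu -> subpart b nu ->
    ((sumn a + sumn b)%:R - M%:R) * T a b =
      w * (\sum_(c <- covered a) T c b + \sum_(d <- covered b) T a d)) ->
  forall j, (M + j = sumn mu + sumn nu)%N ->
  (j`!)%:R * T mu nu = w ^+ j * \sum_(p <- pairs_lt j mu nu) (F2 mu nu p.1 p.2)%:R * T p.1 p.2.
Proof.
move=> pmu pnu rec j ej.
(* At depth i the factor |a| + |b| - M equals j - i for every pair, so i steps produce a falling
   factorial. *)
suff G i : (i <= j)%N -> (j ^_ i)%:R * T mu nu =
    w ^+ i * \sum_(p <- pairs_lt i mu nu) (F2 mu nu p.1 p.2)%:R * T p.1 p.2.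
  by rewrite -ffactnn G.
elim: i => [_|i IH ij].
  rewrite ffactn0 expr0 !mul1r (big_pairs_lt _ _ _ (fun a b => (F2 mu nu a b)%:R * T a b)).
  have muin : mu \in subparts mu by rewrite mem_subparts // pmu subpart_refl.
  have nuin : nu \in subparts nu by rewrite mem_subparts // pnu subpart_refl.
  rewrite (bigD1_seq mu) ?uniq_subparts //= [X in _ + X]big1_seq ?addr0 => [|a].
    rewrite big_mkcond (bigD1_seq nu) ?uniq_subparts //= addn0 eqxx [X in _ + X]big1_seq.
      by rewrite /F2 !subnn bin0 !F_refl addr0 mul1r.
    move=> b /andP [bn]; rewrite mem_subparts // => /andP [pb sb]; case: eqP => // e.
    by case/eqP: bn; apply: subpart_eq => //; move: e; lia.
  case/andP=> an; rewrite mem_subparts // => /andP [pa sa].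
  rewrite big1_seq // => b; rewrite mem_subparts // => /and3P [/eqP e pb sb].
  case/eqP: an; apply: subpart_eq => //.
  by have := subpart_sumn pb pnu sb; move: e; lia.
have {}IH := IH (ltnW ij).
have fE : (j ^_ i.+1)%:R * T mu nu = (j - i)%:R * ((j ^_ i)%:R * T mu nu).
  by rewrite ffactnSr natrM mulrA [_ * (j - i)%:R]mulrC.
rewrite fE IH exprSr -mulrA mulrCA; congr (_ * _).
rewrite (big_pairs_lt _ _ _ (fun a b => (F2 mu nu a b)%:R * T a b)).
rewrite (big_pairs_lt _ _ _ (fun a b => (F2 mu nu a b)%:R * T a b)).
have step a b : a \in subparts mu -> b \in subparts nu ->
    (sumn a + sumn b + i = sumn mu + sumn nu)%N ->
    (j - i)%:R * ((F2 mu nu a b)%:R * T a b) = w * ((F2 mu nu a b)%:R *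
     (\sum_(c <- subparts mu | subpart c a && (sumn a == (sumn c).+1)) T c b
    + \sum_(d <- subparts nu | subpart d b && (sumn b == (sumn d).+1)) T a d)).
  move=> ain bin e; move: (ain) (bin); rewrite !mem_subparts // => /andP [pa sa] /andP [pb sb].
  rewrite -(sum_covered_in (T ^~ b)) // -(sum_covered_in (T a)) // mulrCA [RHS]mulrCA.
  rewrite -rec // -natrB; last by lia.
  by congr (_ * (_%:R * _)); lia.
set P := fun a b : seq nat => (sumn a + sumn b + i == sumn mu + sumn nu)%N.
set Q := fun a b : seq nat => (sumn a + sumn b + i.+1 == sumn mu + sumn nu)%N.
rewrite mulr_sumr; transitivity (w *
   (\sum_(a <- subparts mu) \sum_(b <- subparts nu | P a b)
      \sum_(c <- subparts mu | subpart c a && (sumn a == (sumn c).+1)) (F2 mu nu a b)%:R * T c b +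
    \sum_(a <- subparts mu) \sum_(b <- subparts nu | P a b)
      \sum_(d <- subparts nu | subpart d b && (sumn b == (sumn d).+1)) (F2 mu nu a b)%:R * T a d)).
  rewrite mulrDr !mulr_sumr -big_split big_seq [RHS]big_seq; apply: eq_bigr => a ain.
  rewrite !mulr_sumr -big_split big_seq_cond [RHS]big_seq_cond.
  apply: eq_bigr => b /andP [bin /eqP e] /=.
  by rewrite step // mulrDr mulrDr !mulr_sumr.
congr (_ * _).
(* Exchange of summation: for a fixed lower end of the last step, the counts over its covers are
   collected as in [F2_rec]. *)
have e1 : \sum_(a <- subparts mu) \sum_(b <- subparts nu | P a b)
    \sum_(c <- subparts mu | subpart c a && (sumn a == (sumn c).+1)) (F2 mu nu a b)%:R * T c b =
  \sum_(c <- subparts mu) \sum_(b <- subparts nu | Q c b)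
     (\sum_(a <- covers mu c) F2 mu nu a b)%:R * T c b.
  rewrite (eq_bigr _ (fun a _ => exchange_big _ _ _ _ _ _)) /=.
  rewrite (exchange_big_dep xpredT) //=; apply: eq_bigr => c _.
  transitivity (\sum_(a <- covers mu c) \sum_(b <- subparts nu | Q c b) (F2 mu nu a b)%:R * T c b).
    rewrite big_filter; apply: eq_bigr => a /andP [_ /eqP e].
    by apply: eq_bigl => b; rewrite /P /Q e addSnnS addnS addSn addnS.
  by rewrite exchange_big; apply: eq_bigr => b _; rewrite natr_sum mulr_suml.
have e2 : \sum_(a <- subparts mu) \sum_(b <- subparts nu | P a b)
    \sum_(d <- subparts nu | subpart d b && (sumn b == (sumn d).+1)) (F2 mu nu a b)%:R * T a d =
  \sum_(a <- subparts mu) \sum_(d <- subparts nu | Q a d)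
     (\sum_(b <- covers nu d) F2 mu nu a b)%:R * T a d.
  apply: eq_bigr => a _; rewrite (exchange_big_dep (Q a)) /=; last first.
    by move=> b d /eqP e /andP [_ /eqP e']; rewrite /Q -e e' addnS addnS.
  apply: eq_bigr => d /eqP e; rewrite natr_sum mulr_suml big_filter.
  apply: eq_bigl => b; apply/andP/idP => [[] //|h]; split=> //.
  by case/andP: h => _ /eqP h; rewrite /P -e h addnS addnS.
rewrite e1 e2 -big_split big_seq [RHS]big_seq; apply: eq_bigr => a ain.
rewrite -big_split big_seq_cond [RHS]big_seq_cond; apply: eq_bigr => b /andP [bin /eqP e] /=.
move: ain bin; rewrite !mem_subparts // => /andP [pa sa] /andP [pb sb].
by rewrite -mulrDl -natrD -F2_rec //; lia.
Qed.

(** * Removing dominoes in bead lists *)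

Lemma sumn_big s : sumn s = (\sum_(i < size s) nth 0 s i)%N.
Proof. exact: sumn_nth. Qed.

Lemma jt_derivation (R : comNzRingType) (u : nat -> R) (d : R -> R) (w : R) r ns :
  {morph d : x y / x + y} -> (forall x y, d (x * y) = d x * y + x * d y) ->
  (forall m, m%:R * u m + d (u m) = w * jt_entry u m r) ->
  ((sumn ns)%:R - ('C(size ns, 2))%:R) * jt u ns + d (jt u ns) =
  w * \sum_(j < size ns) (if (r <= nth 0%N ns j)%N then jt u (decr r ns j) else 0).
Proof.
move=> dD dM du; rewrite sumn_big -sum_ord_bin !natr_sum /jt.
rewrite (jtf_derivation _ _ dD dM du); congr (_ * _); apply: eq_bigr => j _.
case: ifP => // _; rewrite size_set_nth (maxn_idPr (ltn_ord j)).
by apply: eq_jtf => l _; rewrite nth_set_nth.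
Qed.

Definition quo_beads a b (mu nu : seq nat) : seq nat :=
  [seq x.*2 | x <- beads a mu] ++ [seq x.*2.+1 | x <- beads b nu].

Lemma size_quo_beads a b mu nu : size (quo_beads a b mu nu) = (a + b)%N.
Proof. by rewrite size_cat !size_map !size_iota. Qed.

Lemma double_inj : injective double. Proof. by move=> x y; lia. Qed.
Lemma doubleS_inj : injective (fun x => x.*2.+1). Proof. by move=> x y; lia. Qed.

Lemma uniq_parity_cat s t :
  uniq ([seq x.*2 | x <- s] ++ [seq x.*2.+1 | x <- t]) = uniq s && uniq t.
Proof.
rewrite cat_uniq (map_inj_uniq double_inj) (map_inj_uniq doubleS_inj).
case: hasPn => //= -[]; move=> _ /mapP [x _ ->]; apply/mapP => -[y _]; lia.
Qed.

Lemma set_nth_catl (s t : seq nat) j v : (j < size s)%N ->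
  set_nth 0%N (s ++ t) j v = set_nth 0%N s j v ++ t.
Proof. by elim: s j => [|x s IH] [|j] //= h; rewrite IH. Qed.

Lemma set_nth_catr (s t : seq nat) j v :
  set_nth 0%N (s ++ t) (size s + j) v = s ++ set_nth 0%N t j v.
Proof. by elim: s => [|x s IH] //=; rewrite IH. Qed.

Lemma map_set_nth (f : nat -> nat) s j v : (j < size s)%N ->
  set_nth 0%N (map f s) j (f v) = map f (set_nth 0%N s j v).
Proof. by elim: s j => [|x s IH] [|j] //= h; rewrite IH. Qed.

(** Lowering an entry 2x or 2x + 1 by two lowers x by one within the same block; the guard [1 <]
    means x > 0 in both cases. *)
Lemma sum_quo_beads (R : nmodType) (T : seq nat -> R) a b mu nu :
  is_part mu -> is_part nu -> (size mu <= a)%N -> (size nu <= b)%N ->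
  (forall s, ~~ uniq s -> T s = 0) ->
  \sum_(j < a + b) (if (1 < nth 0%N (quo_beads a b mu nu) j)%N
     then T (decr 2 (quo_beads a b mu nu) j) else 0) =
  \sum_(c <- covered mu) T (quo_beads a b c nu) + \sum_(d <- covered nu) T (quo_beads a b mu d).
Proof.
move=> pmu pnu sa sb T0; rewrite big_split_ord /=; congr (_ + _).
  rewrite -(@sum_covered _ (fun s => T ([seq x.*2 | x <- s] ++ [seq x.*2.+1 | x <- beads b nu]))) //.
    apply: eq_bigr => j _ /=; have ja : (j < size (beads a mu))%N by rewrite size_beads.
    rewrite /decr /quo_beads nth_cat size_map ja (nth_map 0%N) //.
    case: (posnP (nth 0%N (beads a mu) j)) => [->//|h].
    rewrite ifT; last by lia. rewrite set_nth_catl; last by rewrite size_map.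
    have E := @map_set_nth double (beads a mu) j (nth 0%N (beads a mu) j - 1)%N ja.
    by congr (T (_ ++ _)); rewrite -[RHS]E doubleB.
  by move=> s us; apply: T0; rewrite uniq_parity_cat (negbTE us).
rewrite -(@sum_covered _ (fun s => T ([seq x.*2 | x <- beads a mu] ++ [seq x.*2.+1 | x <- s]))) //.
  apply: eq_bigr => j _ /=; have jb : (j < size (beads b nu))%N by rewrite size_beads.
  rewrite /decr /quo_beads nth_cat size_map size_beads [(a + j < a)%N]ltnNge leq_addr addKn /=.
  have e : (a + j = size [seq x.*2 | x <- beads a mu] + j)%N by rewrite size_map size_beads.
  rewrite e set_nth_catr.
  have nm : nth 0%N [seq x.*2.+1 | x <- beads b nu] j = (nth 0%N (beads b nu) j).*2.+1.
    exact: nth_map.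
  rewrite nm; case: (posnP (nth 0%N (beads b nu) j)) => [->//|h].
  rewrite ltnS double_gt0 h.
  have E := @map_set_nth (fun x => x.*2.+1) (beads b nu) j (nth 0%N (beads b nu) j - 1)%N jb.
  congr (T (_ ++ _)); rewrite -[RHS]E; congr (set_nth _ _ _ _).
  by move: h; case: (nth _ _ _) => // x _; lia.
by move=> s us; apply: T0; rewrite uniq_parity_cat (negbTE us) andbF.
Qed.

(** This is |lambda| = 2(|mu| + |nu|) + |core| in terms of beads: the surplus of k odd beads
    accounts for the staircase (k, ..., 1). *)
Lemma sumn_quo_beads a k mu nu : (size mu <= a)%N -> (size nu <= a + k)%N ->
  sumn (quo_beads a (a + k) mu nu) =
  ((sumn mu + sumn nu).*2 + sumn (iota 1 k) + 'C(a + (a + k), 2))%N.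
Proof.
move=> sa sb; rewrite sumn_cat.
have e1 s : sumn [seq x.*2 | x <- s] = (sumn s).*2.
  by elim: s => //= x s ->; rewrite doubleD.
have e2 s : sumn [seq x.*2.+1 | x <- s] = ((sumn s).*2 + size s)%N.
  by elim: s => //= x s ->; rewrite doubleD; lia.
rewrite e1 e2 !sumn_beads // size_beads.
have -> : sumn (iota 1 k) = 'C(k.+1, 2).
  elim: k {sb} => [|k IH] //; rewrite -[k.+1 in LHS]addn1 iotaD sumn_cat IH /=.
  by rewrite [in RHS]binS bin1 addn0 add1n.
have b2 n : ('C(n, 2) * 2 = n * (n - 1))%N by rewrite bin2 muln2 halfK; case: n => // n; rewrite subn1 /= oddM /= andNb subn0.
have := b2 a; have := b2 (a + k)%N; have := b2 k.+1; have := b2 (a + (a + k))%N.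
move: ('C(_, _)) ('C(_, _)) ('C(_, _)) ('C(_, _)) => x y z t.
by case: a {sa sb} => [|a]; case: k => [|k]; rewrite ?subn1 /=; nia.
Qed.

(** The weight and the exponent both contain |core|, which cancels; dividing by the remaining factor
    2 turns w = -1 into - 1/2. *)
Lemma bead_step_He a k mu nu m : is_part mu -> is_part nu ->
  (size mu <= a)%N -> (size nu <= a + k)%N ->
  let T s t := (jt He_div (quo_beads a (a + k) s t))`_(m.*2 + sumn (iota 1 k)) in
  ((sumn mu + sumn nu)%:R - m%:R) * T mu nu = (- 2%:R^-1) *
   (\sum_(c <- covered mu) T c nu + \sum_(d <- covered nu) T mu d).
Proof.
move=> pmu pnu sa sb T; set K := sumn (iota 1 k).
pose X := quo_beads a (a + k) mu nu.
have sX : size X = (a + (a + k))%N by apply: size_quo_beads.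
have dD : {morph (fun p : {poly rat} => - ('X * p^`())) : x y / x + y}.
  by move=> p q /=; rewrite derivD; ring.
have dM (p q : {poly rat}) : - ('X * (p * q)^`()) = - ('X * p^`()) * q + p * - ('X * q^`()).
  by rewrite derivM; ring.
have := congr1 (fun p : {poly rat} => p`_(m.*2 + K)) (jt_derivation X dD dM He_div_rec).
rewrite sX sum_quo_beads //; last by move=> s; apply: jt_nuniq.
rewrite mulN1r coefN [in RHS]coefD !coef_sum => h.
have {}h : ((sumn mu + sumn nu).*2%:R - m.*2%:R) * T mu nu =
   - (\sum_(c <- covered mu) T c nu + \sum_(d <- covered nu) T mu d).
  rewrite -{}h coefD coefN coefXM -/X; set q := jt He_div X.
  have -> : (if (m.*2 + K == 0)%N then 0 else q^`()`_(m.*2 + K).-1) = (m.*2 + K)%:R * q`_(m.*2 + K).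
    by case: (m.*2 + K)%N => [|l] //=; rewrite ?mul0r // coef_deriv mulr_natl.
  rewrite /X sumn_quo_beads // -/K natrD addrK mulr_natl coefMn -mulr_natl !natrD.
  by rewrite /T -/X -/q -/K; move: (q`_ _) => t; ring.
move: h; rewrite -!muln2 !natrM => h; rewrite mulNr -mulrN -h; by field.
Qed.

Lemma bead_step_dim L l : is_part l -> (size l <= L)%N ->
  (sumn l)%:R * jt fact_inv (beads L l) = \sum_(c <- covered l) jt fact_inv (beads L c).
Proof.
move=> pl sl.
have dD : {morph (fun _ : rat => 0 : rat) : x y / x + y} by move=> *; rewrite addr0.
have dM (x y : rat) : 0 = 0 * y + x * 0 by rewrite mul0r mulr0 addr0.
have := jt_derivation (beads L l) dD dM fact_inv_rec.
rewrite addr0 mul1r size_beads sumn_beads // natrD addrK => ->.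
by rewrite sum_covered // => s; apply: jt_nuniq.
Qed.

(** The additional zero part is a bead at 0, which stands last in the decreasing order. *)
Lemma beads_shift L l : (size l <= L)%N ->
  perm_eq (beads L.+1 l) (0%N :: map S (beads L l)).
Proof.
move=> sl; rewrite perm_sym -(perm_rcons 0%N) perm_sym /beads -(addn1 L) iotaD map_cat cats1 /=.
rewrite add0n nth_default // add0n addn1 subnn -map_comp.
suff -> : [seq (nth 0 l i + L.+1 - i.+1)%N | i <- iota 0 L] =
  [seq (S \o (fun i => nth 0 l i + L - i.+1)%N) i | i <- iota 0 L] by [].
by apply/eq_in_map => i; rewrite mem_iota /= => iL; rewrite addnS subSn //; lia.
Qed.

Lemma jt_dim_nil L : exists e : bool, jt fact_inv (beads L [::]) = (-1) ^+ e.
Proof.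
elim: L => [|L [e IH]].
  by exists false; rewrite /jt /jtf /= det_mx00.
have [e' E] := jt_perm (@beads_shift L [::] isT).
exists (e' (+) e); rewrite E jt_cons0 ?IH ?signr_addb //.
Qed.

Lemma jt_dim_neq0 ns : uniq ns -> jt fact_inv ns != 0.
Proof.
move=> us; rewrite jt_fact_inv mulf_neq0 //; last first.
  by rewrite invr_eq0 prodf_seq_neq0; apply/allP => x _; rewrite fact_neq0.
elim: ns us => [|x s IH] /=; first by [].
case/andP => xs us; rewrite mulf_neq0 ?IH // prodf_seq_neq0; apply/allP => y ys /=.
by rewrite subr_eq0 eqr_nat; apply: contraNneq xs => <-.
Qed.

(** The quotient [N] ignores reordering, since both determinants get the same sign, and beads at 0,
    by [jt_cons0]. *)
Lemma HeP_beads L l ns : is_part l -> (size l <= L)%N -> perm_eq (beads L l) ns ->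
  HeP l = (jt fact_inv ns)^-1 *: jt He_div ns.
Proof.
pose N ns := (jt fact_inv ns)^-1 *: jt He_div ns.
have Nperm s t : perm_eq s t -> N s = N t.
  move=> /jt_perm [e E]; rewrite /N !E -signr_odd.
  by case: e {E} => /=; rewrite ?expr1 ?expr0 ?mul1r // !mulN1r invrN scaleNr scalerN opprK.
move=> pl sl pe; rewrite -/(N ns) -(Nperm _ _ pe) HePE degvecE -/(N _).
elim: L sl {pe} => [|L IH]; first by rewrite leqn0 size_eq0 => /eqP ->.
rewrite leq_eqVlt => /orP [/eqP <- //|]; rewrite ltnS => sl.
rewrite (Nperm _ _ (beads_shift sl)) /N !jt_cons0 ?IH //; first exact: IH.
by rewrite /He_div fact0 invr1 scale1r.
Qed.

Lemma mem_pairs_lt j mu nu p : is_part mu -> is_part nu ->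
  (p \in pairs_lt j mu nu) = [&& is_part p.1, is_part p.2, subpart p.1 mu, subpart p.2 nu &
    sumn p.1 + sumn p.2 + j == sumn mu + sumn nu]%N.
Proof.
move=> pmu pnu; case: p => x y /=; rewrite mem_filter /= andbC.
have -> : ((x, y) \in [seq (a, b) | a <- subparts mu, b <- subparts nu]) =
    (x \in subparts mu) && (y \in subparts nu).
  apply/allpairsP/andP => [[[x' y'] /= [? ? [-> ->]]]|[? ?]]; first by [].
  by exists (x, y).
rewrite !mem_subparts //.
by case: (is_part x); case: (is_part y); case: (subpart x mu); case: (subpart y nu).
Qed.

Lemma uniq_pairs_lt j mu nu : uniq (pairs_lt j mu nu).
Proof.
rewrite filter_uniq // allpairs_uniq ?uniq_subparts // => -[x y] [x' y'] _ _ /= [-> ->].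
by [].
Qed.

Lemma part0 a : is_part a -> sumn a = 0%N -> a = [::].
Proof. by case: a => [|x a] // /andP [_ /= /andP [x0 _]] e; lia. Qed.

(** The hook length formula in determinant form: with M = 0 the empty pair is the only end point of
    [iterate_chains], and its determinants are 1 or -1. The absolute values absorb the signs due to
    the decreasing order. *)
Lemma F2_dim a b mu nu : is_part mu -> is_part nu -> (size mu <= a)%N -> (size nu <= b)%N ->
  (F2 mu nu [::] [::])%:R = ((sumn mu + sumn nu)`!)%:R *
    `|jt fact_inv (beads a mu)| * `|jt fact_inv (beads b nu)|.
Proof.
move=> pmu pnu sa sb.
pose T s t := jt fact_inv (beads a s) * jt fact_inv (beads b t).
have h s t : is_part s -> is_part t -> subpart s mu -> subpart t nu ->
    ((sumn s + sumn t)%:R - 0%:R) * T s t =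
      1 * (\sum_(c <- covered s) T c t + \sum_(d <- covered t) T s d).
  move=> ps pt /andP [ss _] /andP [st _].
  rewrite -mulr_suml -mulr_sumr -!bead_step_dim ?(leq_trans ss) ?(leq_trans st) //.
  by rewrite /T natrD; ring.
have := iterate_chains pmu pnu h (j := (sumn mu + sumn nu)%N) (add0n _).
rewrite expr1n mul1r (perm_big [:: ([::], [::])]); last first.
  apply: uniq_perm; rewrite ?uniq_pairs_lt // => -[x y]; rewrite mem_pairs_lt // inE /=.
  apply/and5P/eqP => [[px py _ _ /eqP e]|[-> ->]].
    move: e; rewrite -[RHS]add0n => /addIn /eqP; rewrite addn_eq0 => /andP [/eqP ex /eqP ey].
    by rewrite (part0 px ex) (part0 py ey).
  by split.
rewrite big_seq1 /= /T; case: (jt_dim_nil a) => e1 ->; case: (jt_dim_nil b) => e2 -> E.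
rewrite -mulrA -normrM -[_`!%:R]ger0_norm // -normrM E !normrM !normrX normrN1 !expr1n !mulr1.
by rewrite ger0_norm.
Qed.

Lemma coef_HeP a k mu nu l j : is_part mu -> is_part nu ->
  (size mu <= a)%N -> (size nu <= a + k)%N ->
  is_part l -> (size l <= a + (a + k))%N ->
  perm_eq (beads (a + (a + k)) l) (quo_beads a (a + k) mu nu) ->
  (j <= sumn mu + sumn nu)%N ->
  (HeP l)`_((sumn mu + sumn nu - j).*2 + sumn (iota 1 k)) =
  (jt fact_inv (quo_beads a (a + k) mu nu))^-1 * ((- 2%:R^-1) ^+ j / (j`!)%:R) *
  \sum_(p <- pairs_lt j mu nu) (F2 mu nu p.1 p.2)%:R * jt fact_inv (quo_beads a (a + k) p.1 p.2).
Proof.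
move=> pmu pnu sa sb pl sl pe jN; set M := (sumn mu + sumn nu - j)%N.
rewrite (HeP_beads pl sl pe) coefZ -!mulrA; congr (_ * _).
pose T s t := (jt He_div (quo_beads a (a + k) s t))`_(M.*2 + sumn (iota 1 k)).
have h s t : is_part s -> is_part t -> subpart s mu -> subpart t nu ->
    ((sumn s + sumn t)%:R - M%:R) * T s t =
      (- 2%:R^-1) * (\sum_(c <- covered s) T c t + \sum_(d <- covered t) T s d).
  move=> ps pt /andP [ss _] /andP [st _].
  by apply: bead_step_He => //; [apply: leq_trans sa | apply: leq_trans sb].
have := iterate_chains pmu pnu h (subnK jN); rewrite -/(T mu nu) => E.
apply: (mulfI (fact_neq0 j)); rewrite E mulrCA; congr (_ * _).
rewrite mulVKf ?fact_neq0 // big_seq [RHS]big_seq; apply: eq_bigr => p.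
rewrite mem_pairs_lt // => /and5P [pp pq /andP [sp _] /andP [sq _] /eqP e].
(* All end points have total size [M], for which the exponent 2M + |core| is the top degree. *)
rewrite -lead_jt_He sumn_quo_beads ?(leq_trans sp) ?(leq_trans sq) //.
by rewrite size_quo_beads addnK /T /M -e addnK.
Qed.

(** * Hook products *)

Local Open Scope nat_scope.

Definition gaps (X : seq nat) (x : nat) : seq nat := [seq y <- iota 0 x | y \notin X].

(** The differences between a bead and the gaps below it are the hook lengths of its row, see
    [row_hooks]; [P] selects all, odd or even ones. *)
Definition hookprod (P : pred nat) (X : seq nat) : nat :=
  \prod_(x <- X) \prod_(y <- gaps X x | P (x - y)) (x - y).

Lemma eq_gaps X Y x : X =i Y -> gaps X x = gaps Y x.
Proof. by move=> e; apply: eq_filter => y; rewrite e. Qed.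

Lemma hookprod_perm P X Y : perm_eq X Y -> hookprod P X = hookprod P Y.
Proof.
move=> pe; rewrite /hookprod (perm_big _ pe); apply: eq_bigr => x _.
by rewrite (eq_gaps x (perm_mem pe)).
Qed.

Lemma hookprodID P X :
  hookprod predT X = hookprod P X * hookprod (fun h => ~~ P h) X.
Proof.
by rewrite /hookprod -big_split; apply: eq_bigr => x _; rewrite (bigID (fun y => P (x - y))).
Qed.

Lemma hookprod_gt0 P X : 0 < hookprod P X.
Proof.
rewrite /hookprod prodn_cond_gt0 // => x _; rewrite big_seq_cond prodn_cond_gt0 // => y.
by rewrite mem_filter mem_iota add0n subn_gt0 => /andP [/and3P [_ _ ->]].
Qed.

Lemma prod_rev_iota x : \prod_(y <- iota 0 x) (x - y) = x`!.
Proof.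
elim: x => [|x IH]; first by rewrite big_nil.
by rewrite /= big_cons subn0 factS -IH (iotaDl 1 0) big_map.
Qed.

(** x! is the product of x - y over all y < x: the vacant y give hooks, the occupied ones the
    absolute value of the Vandermonde product. *)
Lemma fact_hookprod X : uniq X ->
  \prod_(x <- X) x`! = hookprod predT X * \prod_(x <- X) \prod_(y <- X | y < x) (x - y).
Proof.
move=> uX; rewrite /hookprod -big_split; apply: eq_bigr => x _ /=.
have -> : \prod_(y <- X | y < x) (x - y) = \prod_(y <- iota 0 x | y \in X) (x - y).
  rewrite -big_filter -[RHS]big_filter; apply/perm_big/uniq_perm; rewrite ?filter_uniq ?iota_uniq //.
  by move=> y; rewrite !mem_filter mem_iota andbC.
by rewrite big_filter mulnC -prod_rev_iota (bigID (mem X)).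
Qed.

Local Open Scope ring_scope.

Fixpoint ninv (ns : seq nat) : nat :=
  if ns is x :: s then (count (fun y => y < x)%N s + ninv s)%N else 0%N.

Lemma vdm_sign ns : uniq ns ->
  vdm ns = (-1) ^+ ninv ns * (\prod_(x <- ns) \prod_(y <- ns | (y < x)%N) (x - y)%N)%:R.
Proof.
elim: ns => [|x s IH] /=; first by rewrite big_nil mulr1.
case/andP => xs us; rewrite {}IH // big_cons big_cons ltnn.
have -> : (\prod_(z <- s) \prod_(y <- x :: s | y < z) (z - y) =
    \prod_(z <- s) (if x < z then z - x else 1) *
    \prod_(z <- s) \prod_(y <- s | y < z) (z - y))%N.
  by rewrite -big_split; apply: eq_bigr => z _ /=; rewrite big_cons; case: ifP; rewrite ?mul1n.
(* The head x paired with a smaller y gives a sign and a factor of the inner product of x; paired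
   with a larger z, a factor of that of z and no sign. *)
suff E : \prod_(y <- s) (y%:R - x%:R) = (-1) ^+ count (fun y => (y < x)%N) s *
    ((\prod_(y <- s | (y < x)%N) (x - y)%N)%N%:R *
     (\prod_(z <- s) (if (x < z)%N then (z - x)%N else 1%N))%N%:R) :> rat.
  by rewrite E exprD !natrM; ring.
rewrite -natrM [X in (X * _)%N%:R]big_mkcond -big_split /=.
elim: s xs {us} => [|y s IH] /=; first by rewrite !big_nil mulr1.
rewrite inE negb_or => /andP [xy xs]; rewrite !big_cons {}IH // exprD.
rewrite natrM mulrACA; congr (_ * _); case: ltngtP xy => // h _; rewrite ?mul1n ?muln1 ?mul1r.
  by rewrite expr1 mulN1r natrB ?(ltnW h) // opprB.
by rewrite natrB // ltnW.
Qed.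

Lemma jt_dim_hookprod ns : uniq ns ->
  jt fact_inv ns = (-1) ^+ ninv ns / (hookprod predT ns)%:R.
Proof.
move=> us; rewrite jt_fact_inv vdm_sign // -mulrA -natr_prod fact_hookprod // natrM invfM.
rewrite [_^-1 * _^-1]mulrC; congr (_ * _); rewrite mulrA divff ?mul1r // pnatr_eq0 -lt0n.
rewrite prodn_cond_gt0 // => x _; rewrite prodn_cond_gt0 // => y.
by rewrite subn_gt0.
Qed.

Local Open Scope nat_scope.

Lemma size_gaps_beads L l i : is_part l -> i < L ->
  size (gaps (beads L l) (nth 0 (beads L l) i)) = nth 0 l i.
Proof.
move=> pl iL; set X := beads L l; set x := nth 0 X i.
have sX := sorted_beads L pl; have uX := uniq_beads L pl.
have := count_predC (mem X) (iota 0 x); rewrite size_iota -!size_filter.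
(* The occupied places below a bead are the later beads of the list. *)
have -> : size [seq y <- iota 0 x | mem X y] = L - i.+1.
  rewrite -[L in RHS](size_beads L l) -size_drop; apply: perm_size; apply: uniq_perm.
  - by rewrite filter_uniq ?iota_uniq.
  - by rewrite drop_uniq.
  move=> y; rewrite mem_filter mem_iota /= add0n; apply/andP/idP.
    case=> /(nthP 0) [m mX <-] lt; rewrite -/X in mX lt *.
    have im : i < m.
      rewrite ltnNge; apply/negP; rewrite leq_eqVlt => /orP [/eqP e|h].
        by rewrite e ltnn in lt.
      have := @sorted_gtn_nth X m i sX; rewrite h size_beads iL => /(_ isT).
      by move=> h'; have := ltn_trans h' lt; rewrite ltnn.
    rewrite -(subnKC im) -nth_drop mem_nth // size_drop; move: mX; lia.
  case/(nthP 0) => m; rewrite size_drop size_beads => mL <-; rewrite nth_drop.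
  have lt : i < i.+1 + m < size X by rewrite size_beads; lia.
  by split; [apply: mem_nth; case/andP: lt | exact: sorted_gtn_nth lt].
rewrite /gaps -/X /= => e; have : x = nth 0 l i + (L - i.+1) by apply: nth_beads.
have -> : [seq y <- iota 0 x | y \notin X] = [seq x0 <- iota 0 x | predC (mem X) x0] by [].
by move=> ex; apply/eqP; rewrite -(eqn_add2l (L - i.+1)) e ex addnC.
Qed.

Lemma conjpart_gt l i j : is_part l -> (i < conjpart l j) = (j < nth 0 l i).
Proof.
move=> pl; have sl : sorted geq l by case/andP: pl.
rewrite /conjpart {pl}; elim: l i sl => [|x l IH] i st /=; first by rewrite nth_nil !ltn0.
have st' := path_sorted st.
have [jx|xj] := ltnP j x.
  by case: i => [|i] /=; rewrite add1n // ltnS IH.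
rewrite add0n; have z : count (fun x => j < x) l = 0.
  apply/eqP; rewrite -leqn0 leqNgt -has_count; apply/hasPn => y yl; rewrite -leqNgt.
  by rewrite (leq_trans _ xj) //; move/allP: (order_path_min geq_trans st) => /(_ y yl).
rewrite z ltn0; apply/esym/negbTE; rewrite -leqNgt (leq_trans _ xj) //.
exact: (@sorted_geq_nth (x :: l) 0 i st).
Qed.

(* The hooks of row [i] end at the gaps [L - conjpart l j + j], for [j < l_i],
   below the bead of that row. *)
Lemma row_hooks L l i : is_part l -> size l <= L -> i < L ->
  perm_eq [seq hook l i j | j <- iota 0 (nth 0 l i)]
    [seq nth 0 (beads L l) i - y | y <- gaps (beads L l) (nth 0 (beads L l) i)].
Proof.
move=> pl sl iL; set X := beads L l; set x := nth 0 X i.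
pose m j := L - conjpart l j + j.
have cL j : conjpart l j <= L by rewrite (leq_trans (count_size _ _)).
have cmono j j' : j <= j' -> conjpart l j' <= conjpart l j.
  by move=> jj; apply: sub_count => y /= h; apply: leq_ltn_trans h.
have mmono j j' : j < j' -> m j < m j'.
  by move=> jj; rewrite /m; have := cmono j j' (ltnW jj); have := cL j; lia.
have minj : injective m.
  by move=> j j' e; case: (ltngtP j j') => // /mmono; rewrite e ltnn.
have ex : x = nth 0 l i + (L - i.+1) by apply: nth_beads.
have mx j : j < nth 0 l i -> m j < x /\ hook l i j = x - m j.
  move=> h; have := conjpart_gt i j pl; rewrite h => c; have cLj := cL j.
  by rewrite /hook /m ex; split; lia.
have mgap j : m j \notin X.
  apply/(nthP 0) => -[i']; rewrite size_beads => iL'; rewrite nth_beads // => e.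
  have := conjpart_gt i' j pl; have := cL j; move: e; rewrite /m.
  by case: ltnP; case: ltnP => //; lia.
have pm : perm_eq [seq m j | j <- iota 0 (nth 0 l i)] (gaps X x).
  apply: uniq_perm.
  - by rewrite map_inj_uniq ?iota_uniq.
  - by rewrite filter_uniq ?iota_uniq.
  (* The positions are l_i distinct gaps below x, and there are exactly l_i such gaps. *)
  apply: (uniq_min_size _ _ _).2.
  - by rewrite map_inj_uniq ?iota_uniq.
  - move=> y /mapP [j]; rewrite mem_iota => /andP [_ jl] ->.
    by rewrite mem_filter mgap mem_iota /=; case: (mx j jl).
  - by rewrite size_gaps_beads // size_map size_iota.
have -> : [seq hook l i j | j <- iota 0 (nth 0 l i)] =
    [seq x - y | y <- [seq m j | j <- iota 0 (nth 0 l i)]].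
  rewrite -map_comp; apply/eq_in_map => j; rewrite mem_iota => /andP [_ jl].
  by case: (mx j jl).
exact: perm_map.
Qed.

(** * Odd hooks, even hooks and signs *)

Local Open Scope nat_scope.

Lemma Hodd_hookprod L l : is_part l -> size l <= L -> Hodd l = hookprod odd (beads L l).
Proof.
move=> pl sl; rewrite /hookprod (big_nth 0) size_beads /index_iota subn0.
pose row i := \prod_(j <- iota 0 (nth 0 l i) | odd (hook l i j)) hook l i j.
transitivity (\prod_(i <- iota 0 L) row i).
  rewrite -[in RHS](subnKC sl) iotaD big_cat /= [X in _ * X]big1_seq ?muln1 // => i.
  rewrite mem_iota => /andP [_ /andP [h _]]; rewrite /row nth_default //.
  by rewrite big_nil.
rewrite big_seq [RHS]big_seq; apply: eq_bigr => i; rewrite mem_iota => /andP [_ iL].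
rewrite /row -(big_map (hook l i) odd id) (perm_big _ (row_hooks pl sl iL)) big_map.
by [].
Qed.

Lemma mem_quo_beads_even a b mu nu y :
  (y.*2 \in quo_beads a b mu nu) = (y \in beads a mu).
Proof.
rewrite mem_cat (mem_map double_inj); case: (y \in beads a mu) => //=.
by apply/negbTE/mapP => -[z _]; lia.
Qed.

Lemma mem_quo_beads_odd a b mu nu y :
  (y.*2.+1 \in quo_beads a b mu nu) = (y \in beads b nu).
Proof.
rewrite mem_cat (mem_map doubleS_inj) orbC; case: (y \in beads b nu) => //=.
by apply/negbTE/mapP => -[z _]; lia.
Qed.

(** An even difference joins a bead and a gap of equal parity, so it is twice a hook of one
    component. A partition has as many hooks as boxes, whence the power of 2. *)
Lemma hookprod_even a b mu nu : is_part mu -> is_part nu -> size mu <= a -> size nu <= b ->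
  hookprod (fun h => ~~ odd h) (quo_beads a b mu nu) =
  2 ^ (sumn mu + sumn nu) * hookprod predT (beads a mu) * hookprod predT (beads b nu).
Proof.
move=> pmu pnu sa sb; set X := quo_beads a b mu nu.
have Xe := mem_quo_beads_even a b mu nu; have Xo := mem_quo_beads_odd a b mu nu.
have ge u : perm_eq [seq y <- gaps X u.*2 | ~~ odd (u.*2 - y)]
    [seq v.*2 | v <- gaps (beads a mu) u].
  apply: uniq_perm; rewrite ?(map_inj_uniq double_inj) ?filter_uniq ?iota_uniq //.
  move=> y; rewrite !mem_filter mem_iota /=; apply/and3P/mapP.
    case=> o yX lt; exists y./2; last by move: o; rewrite oddB ?odd_double //=; lia.
    have e : y = y./2.*2 by move: o; rewrite oddB ?odd_double //=; lia.
    by rewrite mem_filter mem_iota -Xe -e yX /=; lia.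
  case=> v; rewrite mem_filter mem_iota => /and3P [vX _ lt] ->.
  by rewrite Xe vX -doubleB odd_double; split=> //; lia.
have go u : perm_eq [seq y <- gaps X u.*2.+1 | ~~ odd (u.*2.+1 - y)]
    [seq v.*2.+1 | v <- gaps (beads b nu) u].
  apply: uniq_perm; rewrite ?(map_inj_uniq doubleS_inj) ?filter_uniq ?iota_uniq //.
  move=> y; rewrite !mem_filter mem_iota /=; apply/and3P/mapP.
    case=> o yX lt; have e : y = y./2.*2.+1.
      by move: o; rewrite oddB /= ?odd_double; lia.
    by exists y./2 => //; rewrite mem_filter mem_iota -Xo -e yX /=; lia.
  case=> v; rewrite mem_filter mem_iota => /and3P [vX _ lt] ->.
  by rewrite Xo vX subSS -doubleB odd_double; split=> //; lia.
have dbl L l : is_part l -> size l <= L ->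
    \prod_(u <- beads L l) \prod_(v <- gaps (beads L l) u) (u - v).*2 =
    2 ^ sumn l * hookprod predT (beads L l).
  move=> pl sl; rewrite (sumn_nth sl) expn_sum.
  have -> : \prod_(i < L) 2 ^ nth 0 l i = \prod_(u <- beads L l) 2 ^ size (gaps (beads L l) u).
    by rewrite (big_nth 0) size_beads big_mkord; apply: eq_bigr => i _; rewrite size_gaps_beads.
  rewrite /hookprod -big_split; apply: eq_bigr => u _ /=.
  elim: (gaps _ u) => [|v s IH]; first by rewrite !big_nil.
  by rewrite !big_cons IH /= expnS -mul2n; nia.
rewrite [in LHS]/hookprod /X /quo_beads big_cat (big_map double) (big_map (fun x => x.*2.+1)) /= -/(quo_beads a b mu nu) -/X.
rewrite expnD -mulnA mulnACA -!dbl //; congr (_ * _). apply: eq_bigr => u _.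
  rewrite -big_filter (perm_big _ (ge u)) big_map.
  by apply: eq_bigr => v _; rewrite doubleB.
apply: eq_bigr => u _; rewrite -big_filter (perm_big _ (go u)) big_map.
by apply: eq_bigr => v _; rewrite subSS doubleB.
Qed.

(** Along a decreasing bead list with [true] for odd: the pairs of an even bead and a smaller odd
    one. *)
Fixpoint parity_inv (s : seq bool) : nat :=
  if s is b :: t then (if b then 0 else count id t) + parity_inv t else 0.

Lemma parity_inv_cat s t :
  parity_inv (s ++ t) = parity_inv s + parity_inv t + count negb s * count id t.
Proof.
elim: s => [|b s IH] /=; first by rewrite addn0.
by rewrite IH count_cat; case: b => /=; lia.
Qed.

Lemma parity_inv_swap u b v :
  odd (parity_inv (u ++ [:: b, ~~ b & v])) = ~~ odd (parity_inv (u ++ [:: ~~ b, b & v])).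
Proof.
by rewrite !parity_inv_cat /= !oddD; case: b => /=; rewrite !(oddD, add0n, addn0) /=;
  case: (odd (count _ v)); case: (odd (parity_inv v)); case: (odd (parity_inv u)); case: (odd (_ * _)).
Qed.

(** The same count for a list in any order, which carries it from the blocks of [quo_beads] to the
    decreasing [beads]. *)
Definition even_odd_inv (X : seq nat) : nat :=
  \sum_(x <- X | ~~ odd x) count (fun y => odd y && (y < x)) X.

Lemma even_odd_inv_perm X Y : perm_eq X Y -> even_odd_inv X = even_odd_inv Y.
Proof.
move=> pe; rewrite /even_odd_inv (perm_big _ pe); apply: eq_bigr => x _.
by move/seq.permP: pe => ->.
Qed.

Lemma even_odd_inv_sorted X : sorted gtn X ->
  even_odd_inv X = parity_inv [seq odd x | x <- X].
Proof.
elim: X => [|x s IH] /= st; first by rewrite /even_odd_inv big_nil.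
have lt : forall y, y \in s -> y < x by apply/allP; apply: order_path_min st; apply: gtn_trans.
rewrite -IH ?(path_sorted st) // /even_odd_inv big_cons /= ltnn andbF add0n.
have -> : \sum_(z <- s | ~~ odd z) (odd x && (x < z) + count (fun y => odd y && (y < z)) s) =
    \sum_(z <- s | ~~ odd z) count (fun y => odd y && (y < z)) s.
  rewrite big_seq_cond [RHS]big_seq_cond; apply: eq_bigr => z /andP [/lt zx _].
  by rewrite ltnNge (ltnW zx) andbF.
case: (odd x) => //=; congr (_ + _); rewrite count_map; apply: eq_in_count => y /lt yx.
by rewrite /= yx andbT.
Qed.

Lemma ninv_cat s t :
  ninv (s ++ t) = ninv s + ninv t + \sum_(x <- s) count (fun y => y < x) t.
Proof.
elim: s => [|x s IH] /=; first by rewrite big_nil addn0.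
by rewrite IH count_cat big_cons; lia.
Qed.

Lemma ninv_sorted s : sorted gtn s -> ninv s = 'C(size s, 2).
Proof.
elim: s => [|x s IH] //= st; rewrite IH ?(path_sorted st) // binS bin1 addnC; congr (_ + _).
apply/eqP; rewrite -all_count; apply: order_path_min st; exact: gtn_trans.
Qed.

Lemma sorted_map_mono (f : nat -> nat) s :
  {mono f : x y / x < y} -> sorted gtn s -> sorted gtn (map f s).
Proof. by move=> fm; rewrite sorted_map; apply: sub_sorted => x y; rewrite /= fm. Qed.

(** Inside a decreasing block all pairs are inversions, a constant depending on [a] and [b] alone;
    across the blocks exactly the even-odd inversions remain. *)
Lemma ninv_quo_beads a b mu nu : is_part mu -> is_part nu ->
  ninv (quo_beads a b mu nu) = 'C(a, 2) + 'C(b, 2) + even_odd_inv (quo_beads a b mu nu).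
Proof.
move=> pmu pnu; rewrite /quo_beads ninv_cat.
have sE : sorted gtn [seq x.*2 | x <- beads a mu].
  by apply: sorted_map_mono (sorted_beads a pmu) => x y; rewrite ltn_double.
have sO : sorted gtn [seq x.*2.+1 | x <- beads b nu].
  by apply: sorted_map_mono (sorted_beads b pnu) => x y; rewrite ltnS ltn_double.
rewrite (ninv_sorted sE) (ninv_sorted sO).
rewrite !size_map !size_iota; congr (_ + _).
rewrite /even_odd_inv big_cat /= !(big_map double) (big_map (fun x => x.*2.+1)) [X in _ = _ + X]big1 ?addn0; last first.
  by move=> x; rewrite /= odd_double.
rewrite [RHS](eq_bigl xpredT) => [|x]; last by rewrite odd_double.
apply: eq_bigr => x _; rewrite count_cat [X in _ = X + _](_ : _ = 0) ?add0n.
  by rewrite !count_map; apply: eq_count => y /=; rewrite odd_double.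
rewrite count_map; apply/eqP; rewrite -leqn0 leqNgt -has_count; apply/hasPn => y _ /=.
by rewrite odd_double.
Qed.

Section Domino.
Variables (L : nat) (l c : seq nat).
Hypotheses (pl : is_part l) (pc : is_part c) (sl : size l <= L) (sc : size c <= size l).

Lemma odd_nth_beads m i : i < L -> nth false [seq odd x | x <- beads L m] i =
  odd (nth 0 m i + (L - i.+1)).
Proof. by move=> iL; rewrite (nth_map 0) ?size_beads // nth_beads. Qed.

Lemma hdom_parity : hdom l c -> [seq odd x | x <- beads L c] = [seq odd x | x <- beads L l].
Proof.
case/hasP => i; rewrite mem_iota => /andP [_ il] /andP [/eqP e /allP h].
apply: (@eq_from_nth _ false); rewrite !size_map !size_iota // => k kL.
rewrite !odd_nth_beads //; have [kl|kl] := ltnP k (size l); last first.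
  by rewrite !nth_default // (leq_trans sc).
have := h k; rewrite mem_iota kl => /(_ isT) /orP [/eqP ->|/eqP -> //].
by rewrite e !addSn /= negbK.
Qed.

(** Two equal adjacent rows have beads that differ by one, hence of opposite parity. Both go down by
    one, which exchanges two unequal neighbours of the parity word. *)
Lemma vdom_parity : vdom l c -> odd (parity_inv [seq odd x | x <- beads L c]) =
  ~~ odd (parity_inv [seq odd x | x <- beads L l]).
Proof.
case/hasP => i; rewrite mem_iota => /andP [_ il] /and4P [/eqP e1 /eqP e2 /eqP e3 /allP h].
have il' : i.+1 < size l by rewrite -part_pos // e2.
have iL : i < L by lia. have iL' : i.+1 < L by lia.
set s := [seq odd x | x <- beads L c]; set t := [seq odd x | x <- beads L l].
have st : size t = L by rewrite !size_map size_iota.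
have ss : size s = L by rewrite !size_map size_iota.
pose b := nth false t i.
have ti : nth false t i.+1 = ~~ b.
  by rewrite /b /t !odd_nth_beads // -e3 -[L - i.+1]prednK ?subn_gt0 // -subnS addnS /= negbK.
have si : nth false s i = ~~ b by rewrite /b /s /t !odd_nth_beads // e1 addSn /= negbK.
have si' : nth false s i.+1 = b.
  by rewrite -[b]negbK -ti /s /t !odd_nth_beads // e2 addSn /= negbK.
have other k : k != i -> k != i.+1 -> nth false s k = nth false t k.
  move=> ki ki'; have [kL|kL] := ltnP k L; last by rewrite !nth_default ?ss ?st.
  rewrite /s /t !odd_nth_beads //; have [kl|kl] := ltnP k (size l); last first.
    by rewrite !nth_default // (leq_trans sc).
  by have := h k; rewrite mem_iota kl (negbTE ki) (negbTE ki') => /(_ isT) /= /eqP ->.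
have dec (w : seq bool) : size w = L ->
    w = take i w ++ [:: nth false w i, nth false w i.+1 & drop i.+2 w].
  by move=> sw; rewrite -!drop_nth ?sw // cat_take_drop.
rewrite (dec s ss) (dec t st) si si' ti -/b.
have -> : take i s = take i t.
  apply: (@eq_from_nth _ false); rewrite ?size_take ?ss ?st ?iL // => k ki.
  by rewrite !nth_take //; apply: other; lia.
have -> : drop i.+2 s = drop i.+2 t.
  apply: (@eq_from_nth _ false); rewrite ?size_drop ?ss ?st // => k ki.
  by rewrite !nth_drop; apply: other; lia.
by rewrite parity_inv_swap negbK.
Qed.

End Domino.

(** The parity of the inversions acts as a potential, so the parity of [v] depends only on the two
    ends of the chain. *)
Lemma vchain_parity L j l c v : is_part l -> size l <= L -> vchain j l c v ->
  odd (parity_inv [seq odd x | x <- beads L l]) (+) odd v =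
  odd (parity_inv [seq odd x | x <- beads L c]).
Proof.
elim: j l v => [|j IH] l v pl sl /=; first by case/andP => /eqP -> /eqP ->; rewrite addbF.
case/hasP => d; rewrite mem_subparts // => /andP [pd /andP [sd _]].
have sd' := leq_trans sd sl.
case/orP => [/andP [h vc]|/and3P [h v0 vc]].
  by rewrite -(IH d v) // (hdom_parity L sd h).
rewrite -(IH d v.-1) // (vdom_parity pl pd sl sd h) -{1}(prednK v0) /=.
by case: (odd _); case: (odd _).
Qed.

(** * Bead moves and dominoes *)

Local Open Scope nat_scope.

Lemma gtn_sorted_perm_eq s t : sorted gtn s -> sorted gtn t -> perm_eq s t -> s = t.
Proof.
move=> ss st pe; apply: (irr_sorted_eq gtn_trans ltnn) => // x.
exact: perm_mem.
Qed.

Lemma sorted_set_nth s j v : sorted gtn s -> j < size s -> v <= nth 0 s j ->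
  (j.+1 < size s -> nth 0 s j.+1 < v) -> sorted gtn (set_nth 0 s j v).
Proof.
move=> ss js vj jv; apply/(sortedP 0) => k; rewrite size_set_nth (maxn_idPr js) => ks.
rewrite !nth_set_nth /=; have := @sorted_gtn_nth s k k.+1 ss; rewrite ltnSn ks => /(_ isT) h.
case: (eqVneq k.+1 j) => [e|kj].
  by rewrite ifN; [rewrite (leq_ltn_trans vj) // -e | lia].
by case: (eqVneq k j) => [e|//]; rewrite e jv // -e.
Qed.

Lemma perm_set_nth (s Z : seq nat) j v : j < size s -> perm_eq s (nth 0 s j :: Z) ->
  perm_eq (set_nth 0 s j v) (v :: Z).
Proof.
move=> js; rewrite set_nthE js -[X in perm_eq X _](cat_take_drop j s) (drop_nth 0 js).
rewrite -[_ :: drop _ _]cat1s perm_catCA /= perm_cons => pe.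
by rewrite -[_ :: drop _ _]cat1s perm_catCA /= perm_cons.
Qed.

(* Moving a bead from [y] to [y - 2] removes a horizontal domino when [y - 1] is
   vacant and a vertical one when it is occupied. *)
Lemma bead_domino L l c y Z : is_part l -> is_part c -> size l <= L -> size c <= L ->
  1 < y -> perm_eq (beads L l) (y :: Z) -> perm_eq (beads L c) (y - 2 :: Z) ->
  c \in subparts l /\ (hdom l c || vdom l c).
Proof.
move=> pl pc sl sc y1 el ec; set S := beads L l in el *.
have below z : z < y -> z != y - 1 -> z != y - 2 -> z < y - 2 by clear - y1; lia.
have below1 z : z < y - 1 -> z != y - 2 -> z < y - 2 by clear - y1; lia.
have y10 : y - 1 < y by clear - y1; lia.
have y21 : y - 2 < y - 1 by clear - y1; lia.
have ss := sorted_beads L pl; rewrite -/S in ss.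
have sz : size S = L by apply: size_beads.
have nS : y - 2 \notin S.
  have : uniq (y - 2 :: Z) by rewrite -(perm_uniq ec) uniq_beads.
  rewrite (perm_mem el) inE negb_or => /andP [-> _]; rewrite andbT.
  by rewrite neq_ltn (ltn_trans y21).
have [i iL Si] : exists2 i, i < L & nth 0 S i = y.
  have /(nthP 0) [i iL e] : y \in S by rewrite (perm_mem el) mem_head.
  by exists i; rewrite -?sz.
have neq k v : k < L -> v \notin S -> nth 0 S k != v.
  by move=> kL; apply: contraNneq => <-; rewrite mem_nth ?sz.
have gt k k' : k < k' -> k' < L -> nth 0 S k' < nth 0 S k.
  by move=> kk kL; apply: sorted_gtn_nth => //; rewrite sz kk.
have lS k : k < L -> nth 0 S k = nth 0 l k + (L - k.+1) by apply: nth_beads.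
have cB k : k < L -> nth 0 (beads L c) k = nth 0 c k + (L - k.+1) by apply: nth_beads.
have same k : (k < L -> nth 0 (beads L c) k = nth 0 S k) -> nth 0 l k = nth 0 c k.
  have [kL /(_ isT)|Lk _] := ltnP k L; last by rewrite !nth_default // (leq_trans _ Lk).
  by rewrite lS // cB // => /addIn ->.
have down k v : k < L -> nth 0 (beads L c) k + v = nth 0 S k -> nth 0 l k = nth 0 c k + v.
  by move=> kL; rewrite lS // cB // addnAC => /addIn ->.
have [yZ|yZ] := boolP (y - 1 \in S); last first.
  have cE : beads L c = set_nth 0 S i (y - 2).
    apply: gtn_sorted_perm_eq; first exact: sorted_beads.
      apply: sorted_set_nth => //; rewrite ?sz ?Si ?leq_subr // => iL'.
      by apply: below; [rewrite -Si gt | apply: neq | apply: neq].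
    by rewrite (permPl ec) perm_sym perm_set_nth ?sz // Si.
  have li : nth 0 l i = (nth 0 c i).+2.
    by rewrite -addn2; apply: down => //; rewrite cE nth_set_nth /= eqxx Si subnK.
  have lk k : k != i -> nth 0 l k = nth 0 c k.
    by move=> ki; apply: same => _; rewrite cE nth_set_nth /= (negbTE ki).
  split.
    rewrite mem_subparts // pc; apply/(subpartP pc pl) => k.
    by case: (eqVneq k i) => [->|/lk -> //]; rewrite li -addn2 leq_addr.
  apply/orP; left; apply/hasP; exists i; first by rewrite mem_iota -part_pos // li.
  by rewrite li eqxx; apply/allP => k _; case: (eqVneq k i) => //= /lk ->.
have [iL' Si'] : i.+1 < L /\ nth 0 S i.+1 = y - 1.
  case/(nthP 0): yZ => m; rewrite sz => mL e.
  have im : i < m.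
    case: (ltngtP i m) => // h; first by have := gt m i h iL; rewrite e Si ltnNge (ltnW y10).
    by move: y10; rewrite -e -h Si ltnn.
  split; first exact: leq_ltn_trans mL.
  move: im; rewrite leq_eqVlt => /orP [/eqP -> //|im].
  have := gt i.+1 m im mL; have := gt i i.+1 (ltnSn i) (ltn_trans im mL).
  by rewrite e Si; clear; lia.
(* The moving bead passes the one at y - 1, so in decreasing order two adjacent places each go down
   by one. *)
have cE : beads L c = set_nth 0 (set_nth 0 S i.+1 (y - 2)) i (y - 1).
  have s1 : size (set_nth 0 S i.+1 (y - 2)) = L by rewrite size_set_nth sz (maxn_idPr iL').
  have n1 : nth 0 (set_nth 0 S i.+1 (y - 2)) i = y by rewrite nth_set_nth /= ltn_eqF.
  apply: gtn_sorted_perm_eq; first exact: sorted_beads.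
    apply: sorted_set_nth; rewrite ?s1 ?n1 // ?(ltnW y10) //.
      apply: sorted_set_nth => //; rewrite ?sz ?Si' ?(ltnW y21) // => iL2.
      by apply: below1; [rewrite -Si' gt | apply: neq].
    by rewrite nth_set_nth /= eqxx.
  have /perm_to_rem pZ : y - 1 \in Z by move: yZ; rewrite (perm_mem el) inE (ltn_eqF y10).
  have swap (u v : nat) W : perm_eq (u :: v :: W) (v :: u :: W).
    by rewrite -[u :: _]cat1s -[v :: W]cat1s perm_catCA.
  have p1 : perm_eq (set_nth 0 S i.+1 (y - 2)) (y - 2 :: y :: rem (y - 1) Z).
    apply: perm_set_nth; rewrite ?sz // Si' (permPl el) (permPr (swap _ _ _)) perm_cons.
    exact: pZ.
  rewrite (permPl ec) perm_sym.
  have p2 := @perm_set_nth _ (y - 2 :: rem (y - 1) Z) i (y - 1) _.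
  rewrite (permPl (p2 _ _ _)) ?s1 //; last by rewrite n1 (permPl p1) swap.
  by rewrite (permPl (swap _ _ _)) perm_cons perm_sym.
have li : nth 0 l i = (nth 0 c i).+1.
  by rewrite -[RHS]addn1; apply: down => //; rewrite cE nth_set_nth /= eqxx Si subnK // ltnW.
have li' : nth 0 l i.+1 = (nth 0 c i.+1).+1.
  rewrite -[RHS]addn1; apply: down => //; rewrite cE nth_set_nth /= (gtn_eqF (ltnSn i)) nth_set_nth /= eqxx Si'.
  by clear - y1; lia.
have ll : nth 0 l i = nth 0 l i.+1.
  apply: (@addIn (L - i.+1)); rewrite -lS // Si -[L - i.+1]prednK ?subn_gt0 // -subnS.
  by rewrite addnS -lS // Si'; clear - y1; lia.
have lk k : k != i -> k != i.+1 -> nth 0 l k = nth 0 c k.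
  by move=> ki ki'; apply: same => _; rewrite cE nth_set_nth /= (negbTE ki) nth_set_nth /= (negbTE ki').
split.
  rewrite mem_subparts // pc; apply/(subpartP pc pl) => k.
  case: (eqVneq k i) => [->|ki]; first by rewrite li.
  by case: (eqVneq k i.+1) => [->|ki']; [rewrite li' | rewrite lk].
apply/orP; right; apply/hasP; exists i; first by rewrite mem_iota -part_pos // li.
apply/and4P; split; rewrite ?li ?li' //; first by rewrite -li -li' ll.
by apply/allP => k _; case: (eqVneq k i) => //= ki; case: (eqVneq k i.+1) => //= ki'; rewrite lk.
Qed.

(** The last row i in which [a] exceeds [b] ends in a corner of [a], because a_(i+1) <= b_(i+1) <=
    b_i < a_i. *)
Lemma covered_above b a : is_part a -> is_part b -> subpart b a -> sumn b < sumn a ->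
  exists2 c, c \in covered a & subpart b c.
Proof.
move=> pa pb sb lt; set L := size a.
move/(subpartP pb pa): (sb) => le.
have : exists i, (i < L) && (nth 0 b i < nth 0 a i).
  have [/existsP [i h]|] := boolP [exists i : 'I_L, nth 0 b i < nth 0 a i].
    by exists i; rewrite ltn_ord.
  rewrite negb_exists => /forallP h; case/andP: sb => szb _.
  suff : sumn a <= sumn b by lia.
  by rewrite (sumn_nth szb) (sumn_nth (leqnn _)); apply: leq_sum => i _; rewrite leqNgt h.
move=> ex; have ub j : (j < L) && (nth 0 b j < nth 0 a j) -> j <= L by case/andP=> /ltnW.
case: (ex_maxnP ex ub) => i /andP [iL bi] max.
have ai : nth 0 a i.+1 < nth 0 a i.
  apply: leq_ltn_trans bi; apply: leq_trans (part_nth pb (leqnSn i)).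
  rewrite leqNgt; apply/negP => h; have := max i.+1; rewrite h andbT ltnn => H.
  have : i.+1 < L by rewrite -part_pos // (leq_ltn_trans _ h).
  by move/H.
have ss := sorted_beads L pa; set S := beads L a in ss.
have Si : nth 0 S i = nth 0 a i + (L - i.+1) by apply: nth_beads.
have szd : size (decr 1 S i) = L by rewrite size_set_nth size_beads; apply/maxn_idPr.
have ud : uniq (decr 1 S i).
  apply/gtn_sorted_uniq/sorted_set_nth => //; rewrite ?size_beads ?leq_subr // => iL'.
  by rewrite Si nth_beads //; clear - ai iL'; lia.
have : decr 1 S i \in [seq beads L c | c <- covered a].
  rewrite (perm_mem (beads_covered pa (leqnn _))); apply/mapP; exists i => //.
  by rewrite mem_filter mem_iota -/S ud andbT Si; lia.
case/mapP => c cc e; exists c => //; move: cc; rewrite mem_covered // => /and3P [pc ca _].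
apply/(subpartP pb pc) => k; have [kL|kL] := ltnP k L; last first.
  by rewrite (leq_trans (le k)) // nth_default.
have := congr1 (fun s => nth 0 s k) e; rewrite nth_set_nth /= nth_beads //.
case: eqP => [->|_]; last by rewrite nth_beads // => /addIn <-; apply: le.
by rewrite Si; lia.
Qed.

(** The 2-quotient for a chosen number of beads of each parity; the 2-core enters only through b -
    a. *)
Definition quotient_spec a b (mu nu l : seq nat) : Prop :=
  [/\ is_part l, size l <= a + b & perm_eq (beads (a + b) l) (quo_beads a b mu nu)].

Lemma decr_perm r (s : seq nat) j : j < size s -> exists Z,
  perm_eq s (nth 0 s j :: Z) /\ perm_eq (decr r s j) (nth 0 s j - r :: Z).
Proof.
move=> js; exists (take j s ++ drop j.+1 s); split.
  by rewrite -{1}(cat_take_drop j s) (drop_nth 0 js) -cat1s perm_catCA.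
by rewrite /decr set_nthE js -cat1s perm_catCA.
Qed.

Lemma quotient_step_mu a b mu nu c l l' : is_part mu -> size mu <= a ->
  c \in covered mu -> quotient_spec a b mu nu l -> quotient_spec a b c nu l' ->
  l' \in subparts l /\ (hdom l l' || vdom l l').
Proof.
move=> pmu sa cc [pl sl el] [pl' sl' el'].
have : beads a c \in [seq beads a d | d <- covered mu] by apply: map_f.
rewrite (perm_mem (beads_covered pmu sa)) => /mapP [j]; rewrite mem_filter mem_iota.
case/andP=> /andP [j0 _] /andP [_ ja] e.
have [|Z [p1 p2]] := @decr_perm 1 (beads a mu) j; first by rewrite size_beads.
set y := nth 0 (beads a mu) j in j0 p1 p2.
pose Z' := [seq x.*2 | x <- Z] ++ [seq x.*2.+1 | x <- beads b nu].
apply: (@bead_domino (a + b) _ _ y.*2 Z') => //; first by lia.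
  by rewrite (permPl el) /quo_beads /Z' -cat_cons perm_cat2r -[y.*2 :: _]/(map double (y :: Z)) perm_map.
rewrite (permPl el') /quo_beads e /Z' -cat_cons perm_cat2r.
have dy : y.*2 - 2 = (y - 1).*2 by rewrite doubleB.
by rewrite dy -[_ :: _]/(map double (y - 1 :: Z)) perm_map.
Qed.

Lemma quotient_step_nu a b mu nu d l l' : is_part nu -> size nu <= b ->
  d \in covered nu -> quotient_spec a b mu nu l -> quotient_spec a b mu d l' ->
  l' \in subparts l /\ (hdom l l' || vdom l l').
Proof.
move=> pnu sb cc [pl sl el] [pl' sl' el'].
have : beads b d \in [seq beads b d | d <- covered nu] by apply: map_f.
rewrite (perm_mem (beads_covered pnu sb)) => /mapP [j]; rewrite mem_filter mem_iota.
case/andP=> /andP [j0 _] /andP [_ ja] e.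
have [|Z [p1 p2]] := @decr_perm 1 (beads b nu) j; first by rewrite size_beads.
set y := nth 0 (beads b nu) j in j0 p1 p2.
pose Z' := [seq x.*2 | x <- beads a mu] ++ [seq x.*2.+1 | x <- Z].
have pZ x : perm_eq (x.*2.+1 :: Z')
    ([seq x.*2 | x <- beads a mu] ++ [seq x.*2.+1 | x <- x :: Z]).
  by rewrite /Z' -cat1s perm_catCA.
apply: (@bead_domino (a + b) _ _ y.*2.+1 Z') => //; first by lia.
  by rewrite (permPl el) perm_sym (permPl (pZ y)) /quo_beads perm_cat2l perm_map // perm_sym.
rewrite (permPl el') perm_sym (_ : y.*2.+1 - 2 = (y - 1).*2.+1); last by lia.
by rewrite (permPl (pZ _)) /quo_beads e perm_cat2l perm_map // perm_sym.
Qed.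

(** * The 2-quotient *)

Local Open Scope nat_scope.

Lemma filter_pos_mkseq L l : is_part l -> size l <= L ->
  filter (fun x => 0 < x) (mkseq (nth 0 l) L) = l.
Proof.
move=> pl sl; have st : sorted geq (mkseq (nth 0 l) L).
  apply/(sortedP 0) => i; rewrite size_mkseq => h; rewrite !nth_mkseq ?(ltnW h) //.
  exact: part_nth.
apply: part_ext => // [|i]; first exact: is_part_filter.
rewrite nth_filter_pos //; have [h|h] := ltnP i L; first by rewrite nth_mkseq.
by rewrite !nth_default ?size_mkseq // (leq_trans sl).
Qed.

(** The part of a bead is the number of gaps below it, by [size_gaps_beads]. The window starts at 0,
    so negative places never count as gaps. *)
Lemma lambda_ofP (M : int -> bool) n (B := [seq i <- iota 0 n | M i%:Z]) :
  [/\ is_part (lambda_of M 0 n), size (lambda_of M 0 n) <= size B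
    & perm_eq (beads (size B) (lambda_of M 0 n)) B].
Proof.
have sB : sorted gtn (rev B).
  by rewrite rev_sorted; apply: sorted_filter (iota_ltn_sorted 0 n); apply: ltn_trans.
have [l [pl]] := beads_surj sB; rewrite size_rev => sl bl.
suff -> : lambda_of M 0 n = l by split=> //; rewrite bl perm_rev perm_refl.
have sortl : sorted geq l by case/andP: pl.
apply: (sorted_eq geq_trans) => //.
- by move=> x y /=; rewrite andbC -eqn_leq => /eqP.
- by apply: sort_sorted => x y; apply: leq_total.
have eG : [seq count (fun j : nat => ~~ M (0 + j%:Z)%R) (iota 0 i) | i <- iota 0 n & M (0 + i%:Z)%R] =
    [seq size (gaps B x) | x <- B].
  rewrite (eq_filter (a2 := fun i : nat => M i%:Z)) => [|i]; last by rewrite add0r.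
  apply/eq_in_map => i; rewrite mem_filter mem_iota => /and3P [_ _ iL].
  rewrite size_filter; apply: eq_in_count => y; rewrite mem_iota => /andP [_ yi].
  by rewrite add0r mem_filter mem_iota /= (ltn_trans yi iL) andbT.
rewrite perm_sort eG -[X in perm_eq _ X](filter_pos_mkseq pl sl).
have -> : mkseq (nth 0 l) (size B) = [seq size (gaps B x) | x <- rev B].
  rewrite -bl; apply: (@eq_from_nth _ 0); rewrite size_mkseq ?size_map ?size_iota // => i iB.
  rewrite nth_mkseq // (nth_map 0) ?size_beads // -[LHS](size_gaps_beads pl iB).
  by congr size; apply: eq_gaps => x; rewrite bl mem_rev.
by rewrite map_rev filter_rev perm_sym perm_rev.
Qed.

(** Shifting by s fills the places 0, ..., s - 1, which are the beads of s zero parts. *)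
Lemma maya_shift_nat l s m : maya_shift l s m%:Z = (m \in beads (size l + s) l).
Proof.
have -> : maya_shift l s m%:Z = (m < s) || (m \in [seq n + s | n <- degvec l]).
  rewrite /maya_shift ltz_nat; congr (_ || _).
  by rewrite -(mem_map (f := Posz)) -?map_comp // => x y [].
elim: s m => [|s IH] m.
  by rewrite addn0 -degvecE ltn0 /= (eq_map addn0) map_id.
rewrite addnS (perm_mem (beads_shift (leq_addr _ _))) inE.
case: m => [|m] /=; first by [].
rewrite mem_map; last exact: succn_inj.
rewrite -IH ltnS; congr (_ || _).
by rewrite (eq_map (fun n => addnS n s)) (map_comp S) mem_map //; apply: succn_inj.
Qed.

Lemma nth_le_sumn l i : nth 0 l i <= sumn l.
Proof.
by elim: l i => [|x l IH] [|i] //=; rewrite ?leq_addr // (leq_trans (IH i)) // leq_addl.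
Qed.

Lemma beads_lt L l x : x \in beads L l -> x < sumn l + L.
Proof.
case/(nthP 0) => i; rewrite size_beads => iL <-; rewrite nth_beads //.
by have := nth_le_sumn l i; lia.
Qed.

(** A new bead at 0 in each component fills the places 0 and 1 and moves all other beads up by
    two. *)
Lemma quotient_spec_shift a b mu nu l : size mu <= a -> size nu <= b ->
  quotient_spec a b mu nu l -> quotient_spec a.+1 b.+1 mu nu l.
Proof.
move=> sa sb [pl sl pe]; split=> //; first by rewrite (leq_trans sl) // leq_add.
have sl1 : size l <= (a + b).+1 by apply: leqW.
rewrite addSn addnS (permPl (beads_shift sl1)).
have p1 : perm_eq (0 :: [seq i.+1 | i <- beads (a + b).+1 l])
    [:: 0, 1 & [seq i.+2 | i <- quo_beads a b mu nu]].
  rewrite perm_cons (_ : 1 :: _ = [seq i.+1 | i <- 0 :: [seq i.+1 | i <- quo_beads a b mu nu]]).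
    apply: perm_map; rewrite (permPl (beads_shift sl)) perm_cons; exact: perm_map.
  by rewrite /= -map_comp.
rewrite (permPl p1) perm_sym {p1}.
have e1 : [seq x.*2 | x <- 0 :: map S (beads a mu)] =
    0 :: [seq i.+2 | i <- [seq x.*2 | x <- beads a mu]] by rewrite /= -!map_comp.
have e2 : [seq x.*2.+1 | x <- 0 :: map S (beads b nu)] =
    1 :: [seq i.+2 | i <- [seq x.*2.+1 | x <- beads b nu]] by rewrite /= -!map_comp.
apply: perm_trans (_ : perm_eq _ ([seq x.*2 | x <- 0 :: map S (beads a mu)] ++
   [seq x.*2.+1 | x <- 0 :: map S (beads b nu)])) _.
  by apply: perm_cat; apply: perm_map; apply: beads_shift.
by rewrite e1 e2 /quo_beads map_cat cat_cons perm_cons -cat1s perm_catCA.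
Qed.

(** The minimal shifts in [Phi] give one admissible number of even beads, and [quotient_spec_shift]
    every larger one. A common [a] serves to compare pairs of different lengths. *)
Lemma Phi_spec a k mu nu : is_part mu -> is_part nu ->
  size mu <= a -> size nu <= a + k -> quotient_spec a (a + k) mu nu (Phi mu nu k%:Z).
Proof.
move=> pmu pnu sa sb.
pose e : int := (k%:Z + (size mu)%:Z - (size nu)%:Z)%R.
pose s := absz (Num.max 0 (- e))%R; pose s' := absz (Num.max 0 e)%R.
have [es sle] : size nu + s' = size mu + s + k /\ size mu + s <= a.
  by rewrite /s /s' /e; split; lia.
have spec0 : quotient_spec (size mu + s) (size mu + s + k) mu nu (Phi mu nu k%:Z).
  rewrite -es /Phi -/e -/s -/s'.
  set n := 2 * _ + 2; set M := phi_maya mu nu s s'.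
  have pe : perm_eq [seq i <- iota 0 n | M i%:Z] (quo_beads (size mu + s) (size nu + s') mu nu).
    apply: uniq_perm; first by rewrite filter_uniq ?iota_uniq.
      by rewrite uniq_parity_cat !uniq_beads.
    move=> i; rewrite mem_filter mem_iota /= add0n /M /phi_maya /= divz_nat divn2 !maya_shift_nat.
    have si := odd_double_half i; rewrite -[X in _ = (X \in _)]si.
    case: (odd i) si; rewrite ?add0n ?add1n => si.
      rewrite mem_quo_beads_odd; case: (boolP (_ \in _)) => //= /beads_lt.
      by rewrite /n; lia.
    rewrite mem_quo_beads_even; case: (boolP (_ \in _)) => //= /beads_lt.
    by rewrite /n; lia.
  have [pl sl bl] := lambda_ofP M n.
  have sB := perm_size pe; rewrite size_quo_beads in sB; rewrite sB in sl bl.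
  by split=> //; apply: perm_trans pe.
have sb0 : size nu <= size mu + s + k by rewrite -es leq_addr.
move: spec0 sle sb0; move: (size mu + s) (leq_addr s (size mu)) => a0 sa0 spec0 le sb0.
rewrite -(subnKC le); elim: (a - a0) => [|d IH]; first by rewrite addn0.
rewrite addnS addSn; apply: quotient_spec_shift => //.
  by rewrite (leq_trans sa0) // leq_addr.
by rewrite (leq_trans sb0) // leq_add2r leq_addr.
Qed.

(** * Domino chains, signs and the coefficient formula *)

Lemma vchain_refl a : vchain 0 a a 0.
Proof. by rewrite /= !eqxx. Qed.

Lemma vchain_hdom j a b c v :
  c \in subparts a -> hdom a c -> vchain j c b v -> vchain j.+1 a b v.
Proof. by move=> ca h vc; apply/hasP; exists c => //; apply/orP; left; apply/andP. Qed.

Lemma vchain_vdom j a b c v :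
  c \in subparts a -> vdom a c -> vchain j c b v -> vchain j.+1 a b v.+1.
Proof. by move=> ca h vc; apply/hasP; exists c => //; apply/orP; right; apply/and3P. Qed.

(** Boxes are removed from [mu] until [m] is reached, then from [nu]; each removal moves a bead of
    lambda by two places, hence removes a domino. *)
Lemma vchain_exists a k mu nu m n j :
  is_part mu -> is_part nu -> size mu <= a -> size nu <= a + k ->
  is_part m -> is_part n -> subpart m mu -> subpart n nu ->
  sumn m + sumn n + j = sumn mu + sumn nu ->
  exists2 v, v <= j & vchain j (Phi mu nu k%:Z) (Phi m n k%:Z) v.
Proof.
move=> pmu pnu sa sb pm pn sm sn.
elim: j mu nu pmu pnu sa sb sm sn => [|j IH] mu nu pmu pnu sa sb sm sn ej.
  have lm := subpart_sumn pm pmu sm; have ln := subpart_sumn pn pnu sn.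
  have -> : m = mu by apply: subpart_eq => //; lia.
  have -> : n = nu by apply: subpart_eq => //; lia.
  by exists 0 => //; apply: vchain_refl.
have spec := Phi_spec pmu pnu sa sb.
suff [mu' [nu' [[pmu' pnu' sa' sb'] [sm' sn' e'] [inl dom]]]] : exists mu' nu',
    [/\ [/\ is_part mu', is_part nu', size mu' <= a & size nu' <= a + k],
      [/\ subpart m mu', subpart n nu' & sumn m + sumn n + j = sumn mu' + sumn nu'] &
      Phi mu' nu' k%:Z \in subparts (Phi mu nu k%:Z) /\
      (hdom (Phi mu nu k%:Z) (Phi mu' nu' k%:Z) || vdom (Phi mu nu k%:Z) (Phi mu' nu' k%:Z))].
  have [v vj vc] := IH mu' nu' pmu' pnu' sa' sb' sm' sn' e'.
  case/orP: dom => h; first by exists v; [apply: leqW | apply: vchain_hdom inl h vc].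
  by exists v.+1; [| apply: vchain_vdom inl h vc].
have [lt|ge] := ltnP (sumn m) (sumn mu).
  have [c cc mc] := covered_above pmu pm sm lt.
  move: (cc); rewrite mem_covered // => /and3P [pc /andP [sc _] /eqP ec].
  have sca := leq_trans sc sa.
  exists c, nu; split; first by [].
    by split=> //; move: ec ej; clear; lia.
  exact: quotient_step_mu cc spec (Phi_spec pc pnu sca sb).
have em := subpart_eq pm pmu sm ge.
have lt : sumn n < sumn nu by move: ej; rewrite em; lia.
have [c cc mc] := covered_above pnu pn sn lt.
move: (cc); rewrite mem_covered // => /and3P [pc /andP [sc _] /eqP ec].
have sca := leq_trans sc sb.
exists mu, c; split; first by [].
  by split=> //; move: ec ej; clear; lia.
exact: quotient_step_nu cc spec (Phi_spec pmu pc sa sca).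
Qed.

Lemma even_odd_inv_spec a b mu nu l : quotient_spec a b mu nu l ->
  even_odd_inv (quo_beads a b mu nu) = parity_inv [seq odd x | x <- beads (a + b) l].
Proof.
case=> pl sl pe; rewrite -(even_odd_inv_perm pe) even_odd_inv_sorted //.
exact: sorted_beads.
Qed.

Local Open Scope ring_scope.

(** [ht2] is found by a search, which succeeds by [vchain_exists]; the parity of whatever it finds
    is fixed by [vchain_parity]. *)
Lemma ht2_sign a k mu nu m n j :
  is_part mu -> is_part nu -> (size mu <= a)%N -> (size nu <= a + k)%N ->
  is_part m -> is_part n -> subpart m mu -> subpart n nu ->
  (sumn m + sumn n + j = sumn mu + sumn nu)%N ->
  (-1) ^+ ht2 j (Phi mu nu k%:Z) (Phi m n k%:Z) =
  (-1) ^+ even_odd_inv (quo_beads a (a + k) mu nu) *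
  (-1) ^+ even_odd_inv (quo_beads a (a + k) m n) :> rat.
Proof.
move=> pmu pnu sa sb pm pn sm sn ej.
have [v vj vc] := vchain_exists pmu pnu sa sb pm pn sm sn ej.
have h : has (vchain j (Phi mu nu k%:Z) (Phi m n k%:Z)) (iota 0 j.+1).
  by apply/hasP; exists v; rewrite // mem_iota.
have := nth_find 0%N h; rewrite -/(ht2 _ _ _) nth_iota ?add0n; last first.
  by move: h; rewrite has_find size_iota.
have spec := Phi_spec pmu pnu sa sb; have [pl sl _] := spec.
have sma : (size m <= a)%N by case/andP: sm => /leq_trans ->.
have snb : (size n <= a + k)%N by case/andP: sn => /leq_trans ->.
move/(vchain_parity pl sl) => e.
rewrite -exprD -signr_odd -[RHS]signr_odd oddD (even_odd_inv_spec spec).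
rewrite (even_odd_inv_spec (Phi_spec pm pn sma snb)) -e addbA addbb addFb.
by [].
Qed.

(** The hooks of lambda split into odd and even ones; the latter contribute 2^N times the hook
    products of [mu] and [nu], which multiply to N! / F2 by [F2_dim]. *)
Lemma jt_dim_quo_beads a k mu nu : is_part mu -> is_part nu ->
  (size mu <= a)%N -> (size nu <= a + k)%N ->
  jt fact_inv (quo_beads a (a + k) mu nu) =
  (-1) ^+ ('C(a, 2) + 'C(a + k, 2) + even_odd_inv (quo_beads a (a + k) mu nu)) *
  (F2 mu nu [::] [::])%:R / ((Hodd (Phi mu nu k%:Z))%:R * 2%:R ^+ (sumn mu + sumn nu) *
    ((sumn mu + sumn nu)`!)%:R).
Proof.
move=> pmu pnu sa sb; have [pl sl pe] := Phi_spec pmu pnu sa sb.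
have uX : uniq (quo_beads a (a + k) mu nu) by rewrite uniq_parity_cat !uniq_beads.
rewrite jt_dim_hookprod // ninv_quo_beads // -mulrA; congr (_ * _).
rewrite (hookprodID odd) hookprod_even // -(hookprod_perm _ pe) -Hodd_hookprod //.
rewrite (F2_dim pmu pnu sa sb) !jt_dim_hookprod ?uniq_beads // !normrM !normrX normrN1 !expr1n.
rewrite !mul1r !normfV !ger0_norm // !natrM natrX.
have inv (t h f g x : rat) : x != 0 ->
    (h * (t * f * g))^-1 = x / f / g / (h * t * x).
  move=> x0; rewrite !invfM -!mulrA [x * _]mulrC -!mulrA; rewrite mulVf // mulr1.
  by rewrite mulrCA [f^-1 * _]mulrC; ring.
by apply: inv; apply: fact_neq0.
Qed.

Lemma Hodd_neq0 l : is_part l -> (Hodd l)%:R != 0 :> rat.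
Proof.
by move=> pl; rewrite (Hodd_hookprod pl (leqnn _)) pnatr_eq0 -lt0n hookprod_gt0.
Qed.

Lemma F2_neq0 mu nu : is_part mu -> is_part nu -> (F2 mu nu [::] [::])%:R != 0 :> rat.
Proof.
move=> pmu pnu; rewrite (F2_dim pmu pnu (leqnn _) (leqnn _)).
by rewrite !mulf_neq0 ?fact_neq0 // normr_eq0 jt_dim_neq0 // uniq_beads.
Qed.

(** Here s is the constant sign, i1 and i2 are the even-odd signs, f, f', g chain counts, h, h' odd
    hook products, p = 2^j, q = 2^(N-j), x = j!, y = (N-j)!, c the binomial coefficient and e =
    (-1)^j. *)
Lemma cancel_dims (s i1 i2 f f' g h h' p q x y c e : rat) :
  s * s = 1 -> i1 * i1 = 1 ->
  f != 0 -> h' != 0 -> p != 0 -> q != 0 -> x != 0 -> y != 0 ->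
  (s * i1 * f / (h * (p * q) * (c * (x * y))))^-1 * (e / p / x) *
    (g * (s * i2 * f' / (h' * q * y))) =
  e * c * (i1 * i2 * (f' * g / f) * (h / h')).
Proof.
move=> ss ii f0 h0 p0 q0 x0 y0.
have inv1 z : z * z = 1 -> z^-1 = z :> rat.
  move=> zz; have z0 : z != 0 by apply: contra_eq_neq zz => ->; rewrite mul0r.
  by apply: (mulfI z0); rewrite zz divff.
rewrite invf_div !invfM (inv1 _ ss) (inv1 _ ii) -[RHS]mul1r -ss.
by field; rewrite f0 h0 p0 q0 x0 y0.
Qed.

Theorem theorem4p4 (mu nu : seq nat) (k : nat) (R : {poly rat}) :
  is_part mu -> is_part nu ->
  (* R = R_lambda, where He_lambda(x) = x^{|core|} R_lambda(x^2), core = (k,...,1) *)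
  HeP (Phi mu nu k%:Z) = 'X^(sumn (iota 1 k)) * (R \Po 'X^2) ->
  forall j : nat, (j <= sumn mu + sumn nu)%N ->
  R`_(sumn mu + sumn nu - j) =
    (-1) ^+ j * ('C(sumn mu + sumn nu, j))%:R *
    \sum_(p <- pairs_lt j mu nu)
       (-1) ^+ (ht2 j (Phi mu nu k%:Z) (Phi p.1 p.2 k%:Z)) *
       ((F2 p.1 p.2 [::] [::])%:R * (F2 mu nu p.1 p.2)%:R
          / (F2 mu nu [::] [::])%:R) *
       ((Hodd (Phi mu nu k%:Z))%:R / (Hodd (Phi p.1 p.2 k%:Z))%:R).
Proof.
move=> pmu pnu HR j jN; set N := (sumn mu + sumn nu)%N in jN *.
(* Enough even beads for [mu] and, with k more, odd beads for [nu], hence for all smaller pairs. *)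
pose a := (size mu + size nu)%N.
have sa : (size mu <= a)%N by apply: leq_addr.
have sb : (size nu <= a + k)%N by rewrite /a -addnA addnCA leq_addr.
have [pl sl pe] := Phi_spec pmu pnu sa sb.
have -> : R`_(N - j) = (HeP (Phi mu nu k%:Z))`_((N - j).*2 + sumn (iota 1 k)).
  rewrite HR coefXnM ltnNge leq_addl /= addnK coef_comp_poly_Xn //.
  by rewrite -muln2 dvdn_mull // mulnK.
rewrite (coef_HeP pmu pnu sa sb pl sl pe jN) !mulr_sumr big_seq [RHS]big_seq.
apply: eq_bigr => -[m n]; rewrite mem_pairs_lt //= => /and5P [pm pn sm sn /eqP ej].
have sma : (size m <= a)%N by case/andP: sm => /leq_trans ->.
have snb : (size n <= a + k)%N by case/andP: sn => /leq_trans ->.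
rewrite (ht2_sign pmu pnu sa sb pm pn sm sn ej) !jt_dim_quo_beads // -/N.
have eN : (sumn m + sumn n = N - j)%N by rewrite /N -ej addnK.
(* With [N] opaque, [exprD] splits only the exponents of the signs. *)
have bf := bin_fact jN; rewrite {}eN; clearbody N; rewrite !exprD.
have [pl' _ _] := Phi_spec pm pn sma snb.
have -> : 2%:R ^+ N = 2%:R ^+ j * 2%:R ^+ (N - j) :> rat by rewrite -exprD subnKC.
have -> : (- 2%:R^-1) ^+ j = (-1) ^+ j / 2%:R ^+ j :> rat by rewrite [LHS]exprNn exprVn.
have -> : (N`!)%:R = ('C(N, j))%:R * ((j`!)%:R * ((N - j)`!)%:R) :> rat.
  by rewrite -!natrM bf.
have sqr1 i : (-1) ^+ i * (-1) ^+ i = 1 :> rat by rewrite -expr2 sqrr_sign.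
apply: cancel_dims; rewrite ?fact_neq0 ?expf_neq0 ?Hodd_neq0 ?F2_neq0 //.
by rewrite mulrACA !sqr1 mulr1.
Qed.
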